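(* Let $H$ be a finite dimensional semisimple Hopf algebra over $k=\mathbb{C}$ and let $K, L$ be two Hopf subalgebras of $H$. Consider the linear operator $T$ on the character ring $C(H^* )\subset H$ given by $T(x)=\Lambda_K\,x\,\Lambda_L$, and let $[T]$ be the matrix of $T$ with respect to the basis of $C(H^* )$ given by the irreducible characters of $H^*$. Let $\mathcal{C}_1,\dots,\mathcal{C}_l$ be the equivalence classes of $r^H_{K,L}$ on $\mathrm{Irr}(H^* )$ and let $a_i=\sum_{d\in\mathcal{C}_i}\epsilon(d)d$ for $1\le i\le l$. Then: (1) The principal eigenvalue of $[T]$ is $|K||L|$. (2) The eigenspace of $T$ corresponding to the eigenvalue $|K||L|$ has $(a_i)_{1\le i\le l}$ as a $k$-basis.
   Context: $|V|=\dim_k V$. The character ring $C(H^* )$ of the dual Hopf algebra $H^*$ is viewed as a subalgebra of $H=H^{**}$, and $\mathrm{Irr}(H^* )\subset C(H^* )$ is the set of irreducible characters of $H^*$. Each $d\in\mathrm{Irr}(H^* )$ corresponds to a simple subcoalgebra $C_d$ of $H$: $C_d$ has a basis $\{x_{ij}\}_{1\le i,j\le q}$ with $\Delta(x_{ij})=\sum_{s=1}^q x_{is}\otimes x_{sj}$, $d=\sum_{i=1}^q x_{ii}$ and $\epsilon(d)=q$. $\Lambda_K\in K$ and $\Lambda_L\in L$ are the integrals with $\epsilon(\Lambda_K)=|K|$ and $\epsilon(\Lambda_L)=|L|$; they lie in $C(H^* )$. The equivalence relation $r^H_{K,L}$ on $\mathrm{Irr}(H^* )$ is: $c\sim d$ if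 and only if $C_c\subset KC_dL$; equivalently, $m(c,\Lambda_K d\Lambda_L)>0$, where $m$ is the bilinear form on $C(H^* )$ with $m(c,d)=\dim_k\mathrm{Hom}^H(M,N)$ when $c,d$ are the characters of $H$-comodules $M,N$. The matrix $[T]$ has nonnegative entries; the principal eigenvalue of a matrix with nonnegative entries is its nonnegative real eigenvalue of largest absolute value among all eigenvalues (Frobenius–Perron). *)

(* Defs.v *)
From HB Require Import structures.
From mathcomp Require Import all_boot all_order all_algebra all_field.
From mathcomp Require Import boolp classical_sets reals.
From mathcomp Require Import complex.

Set Implicit Arguments.
Unset Strict Implicit.
Unset Printing Implicit Defensive.

Import Order.TTheory GRing.Theory Num.Theory.
Local Open Scope ring_scope.

(* U (x) V is realised as Hom(U^*, V), with u (x) v the map f |-> f(u) v;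
   [tlift_tens] and [tens_span] are the universal property. *)
Section Tensor.
Variable k : fieldType.
Implicit Types U V W : vectType k.

Definition tensor U V : vectType k := 'Hom('Hom(U, k^o), V).

Definition evalv U (u : U) (f : 'Hom(U, k^o)) : k := f u.

Definition tens U V (u : U) (v : V) : tensor U V :=
  linfun (fun f : 'Hom(U, k^o) => evalv u f *: v).

Definition dual_basis U (i : 'I_(\dim {:U})) : 'Hom(U, k^o) :=
  linfun (coord (vbasis {:U}) i : U -> k^o).

(* The linear map U (x) V -> W induced by a bilinear map B : U -> V -> W. *)
Definition tlift U V W (B : U -> V -> W) (t : tensor U V) : W :=
  \sum_(i < \dim {:U}) B (vbasis {:U})`_i (t (dual_basis i)).

(* The image of A (x) B in U (x) V. *)
Definition tensv U V (A : {vspace U}) (B : {vspace V}) :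
    {vspace (tensor U V)} :=
  <<[seq tens a b | a <- vbasis A, b <- vbasis B]>>%VS.

Lemma tensE U V (u : U) (v : V) f : tens u v f = (f u : k) *: v.
Proof.
have lin : linear (fun f : 'Hom(U, k^o) => evalv u f *: v).
  by move=> a f1 f2; rewrite /evalv add_lfunE scale_lfunE scalerDl scalerA.
pose m := GRing.isLinear.Build _ _ _ _ _ lin.
pose F : {linear 'Hom(U, k^o) -> V} := HB.pack (fun f => evalv u f *: v) m.
by rewrite /tens -[LHS]/(linfun F f) lfunE.
Qed.

Lemma dual_basisE U i (u : U) : dual_basis i u = coord (vbasis {:U}) i u.
Proof. by rewrite /dual_basis lfunE. Qed.

Lemma tlift_tens U V W (B : U -> V -> W)
    (linl : forall v, linear (B^~ v)) (linr : forall u, linear (B u)) u v :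
  tlift B (tens u v) = B u v.
Proof.
have B0 w : B 0 w = 0.
  by have := linl w (-1) 0 0; rewrite scaler0 addr0 scaleN1r addNr.
have BD w x y : B (x + y) w = B x w + B y w.
  by have := linl w 1 x y; rewrite !scale1r.
have BZ w a x : B (a *: x) w = a *: B x w.
  by have := linl w a x 0; rewrite !addr0 B0 addr0.
have Br0 x : B x 0 = 0.
  by have := linr x (-1) 0 0; rewrite scaler0 addr0 scaleN1r addNr.
have BrZ x a w : B x (a *: w) = a *: B x w.
  by have := linr x a w 0; rewrite !addr0 Br0 addr0.
rewrite {2}(coord_vbasis (memvf u)) (big_morph (B^~ v) (BD v) (B0 v)).
by apply: eq_bigr => i _; rewrite tensE BrZ BZ dual_basisE.
Qed.

Lemma tlift_linear U V W (B : U -> V -> W) :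
  (forall u, linear (B u)) -> linear (tlift B).
Proof.
move=> linr a s t; rewrite /tlift scaler_sumr -big_split; apply: eq_bigr => i _.
by rewrite add_lfunE scale_lfunE linr.
Qed.

Lemma tens_span U V (t : tensor U V) :
  t = \sum_(i < \dim {:U}) tens (vbasis {:U})`_i (t (dual_basis i)).
Proof.
have fr : free (vbasis {:U}) := basis_free (vbasisP _).
apply/lfunP => f; rewrite sum_lfunE.
have -> : f = \sum_(i < \dim {:U}) f (vbasis {:U})`_i *: dual_basis i.
  apply/lfunP => u; rewrite sum_lfunE {1}(coord_vbasis (memvf u)) linear_sum.
  apply: eq_bigr => i _.
  by rewrite linearZ scale_lfunE dual_basisE /= /GRing.scale /= mulrC.
rewrite linear_sum; apply: eq_bigr => i _; rewrite linearZ tensE; congr (_ *: _).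
rewrite sum_lfunE (bigD1 i) //= scale_lfunE dual_basisE.
rewrite (coord_free _ _ fr) eqxx big1 ?addr0.
  by rewrite /GRing.scale /= mulr1.
move=> j ji; rewrite scale_lfunE dual_basisE.
rewrite (coord_free _ _ fr) eq_sym (negPf ji).
by rewrite /GRing.scale /= mulr0.
Qed.

End Tensor.

Notation "U ⊗ V" := (tensor U V) (at level 40, left associativity) : type_scope.
Notation "u ⊗ v" := (tens u v) (at level 40, left associativity) : ring_scope.

(* (a (x) b) (c (x) d) = ac (x) bd *)
Definition tmul (k : fieldType) (A : falgType k) (s t : (A ⊗ A)%type) :
    (A ⊗ A)%type :=
  tlift (fun a b => tlift (fun c d => (a * c) ⊗ (b * d)) t) s.

HB.mixin Record isHopf (k : fieldType) H of Falgebra k H := {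
  comul : 'Hom(H, (H ⊗ H)%type);
  counit : 'Hom(H, k^o);
  antipode : 'End(H);
  comulA : forall x : H,
    tlift (fun a b => tlift (fun a1 a2 => a1 ⊗ (a2 ⊗ b)) (comul a)) (comul x) =
    tlift (fun a b => a ⊗ comul b) (comul x);
  counitl : forall x : H,
    tlift (fun a b => (counit a : k) *: b) (comul x) = x;
  counitr : forall x : H,
    tlift (fun a b => (counit b : k) *: a) (comul x) = x;
  comul1 : comul 1 = 1 ⊗ 1;
  comulM : forall x y : H, comul (x * y) = tmul (comul x) (comul y);
  counit1 : counit 1 = 1 :> k;
  counitM : forall x y : H, counit (x * y) = (counit x : k) * counit y :> k;
  antipodel : forall x : H,
    tlift (fun a b => antipode a * b) (comul x) = (counit x : k)%:A;
  antipoder : forall x : H,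
    tlift (fun a b => a * antipode b) (comul x) = (counit x : k)%:A
}.

#[short(type="hopfType")]
HB.structure Definition Hopf k := {H of isHopf k H & Falgebra k H}.

Arguments comul {k H} : rename.
Arguments counit {k H} : rename.
Arguments antipode {k H} : rename.

(* The left regular module is semisimple. *)
Definition left_ideal (k : fieldType) (A : falgType k) (I : {vspace A}) : bool :=
  (fullv * I <= I)%VS.

Definition semisimple (k : fieldType) (A : falgType k) : Prop :=
  forall I : {vspace A}, left_ideal I ->
    exists J : {vspace A},
      [/\ left_ideal J, (I + J = fullv)%VS & (I :&: J = 0)%VS].

Section HopfNotions.
Variables (k : fieldType) (H : hopfType k).

(* An {aspace H} may have its own unit, hence the requirement 1 \in K. *)
Definition hopf_subalgebra (K : {aspace H}) : Prop :=
  [/\ 1 \in K,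
      forall x, x \in K -> comul x \in tensv K K
    & forall x, x \in K -> antipode x \in K].

(* Two-sided, as K is unimodular in the semisimple case. Not normalised. *)
Definition hopf_integral (K : {vspace H}) (x : H) : Prop :=
  x \in K /\
  forall y, y \in K ->
    y * x = (counit y : k) *: x /\ x * y = (counit y : k) *: x.

(* The product of the dual algebra H^*, whose unit is the counit of H. *)
Definition conv (f g : 'Hom(H, k^o)) : 'Hom(H, k^o) :=
  linfun (fun x : H =>
    tlift (fun a b => ((f a : k) * g b : k^o)) (comul x)).

Lemma convE f g x :
  conv f g x = tlift (fun a b => ((f a : k) * g b : k^o)) (comul x).
Proof.
set B := (X in tlift X); pose F x := tlift B (comul x).
have lin : linear F.
  move=> a y z; rewrite /F linearP; apply: tlift_linear => u b v w.
  by rewrite /B linearP /= mulrDr; congr (_ + _); rewrite /GRing.scale /= mulrCA.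
pose G : {linear H -> k^o} := HB.pack F (GRing.isLinear.Build _ _ _ _ _ lin).
by rewrite /conv -[LHS]/(linfun G x) lfunE.
Qed.

Definition dual_repr n (rho : {linear 'Hom(H, k^o) -> 'M[k]_n}) : Prop :=
  rho counit = 1%:M /\ forall f g, rho (conv f g) = rho f *m rho g.

Definition dual_irr n (rho : {linear 'Hom(H, k^o) -> 'M[k]_n}) : Prop :=
  [/\ dual_repr rho, (0 < n)%N
    & forall U : 'M[k]_n, (forall f, stablemx U (rho f)) ->
        \rank U = 0 \/ \rank U = n].

(* Characters of H^* are elements of H^** = H: d is identified with f |-> f d. *)
Definition affords n (rho : {linear 'Hom(H, k^o) -> 'M[k]_n}) (d : H) : Prop :=
  forall f : 'Hom(H, k^o), f d = \tr (rho f) :> k.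

Definition dual_char (d : H) : Prop :=
  exists n (rho : {linear 'Hom(H, k^o) -> 'M[k]_n}),
    dual_repr rho /\ affords rho d.

Definition irr_dual_char (d : H) : Prop :=
  exists n (rho : {linear 'Hom(H, k^o) -> 'M[k]_n}),
    dual_irr rho /\ affords rho d.

Definition is_span (P : H -> Prop) (U : {vspace H}) : Prop :=
  (forall x, P x -> x \in U) /\
  forall W : {vspace H}, (forall x, P x -> x \in W) -> (U <= W)%VS.

Lemma is_span_ex P : exists U, is_span P U.
Proof.
pose Q (U : {vspace H}) := forall x, P x -> x \in U.
pose p n : bool := `[< exists2 U, Q U & \dim U = n >].
have exn : exists n, p n.
  by exists (\dim {:H}); apply/asboolP; exists {:H}%VS => // x _; apply: memvf.
case: (ex_minnP exn) => n /asboolP[U QU dU] minn.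
exists U; split=> // W QW; apply/capv_idPl/eqP.
rewrite eqEdim capvSl /= dU; apply: minn; apply/asboolP.
by exists (U :&: W)%VS => // x Px; rewrite memv_cap QU ?QW.
Qed.

Definition char_ring : {vspace H} := xget 0%VS [set U | is_span dual_char U].

Lemma char_ringP : is_span dual_char char_ring.
Proof.
by rewrite /char_ring; case: xgetP => // noU; case: (is_span_ex dual_char) => U /noU.
Qed.

(* C is the simple subcoalgebra C_d of H corresponding to the character d. *)
Definition subcoalg_of (d : H) (C : {vspace H}) : Prop :=
  exists q (x : 'M[H]_q),
    [/\ basis_of C [seq x ij.1 ij.2 | ij : 'I_q * 'I_q],
        forall i j, comul (x i j) = \sum_s x i s ⊗ x s j,
        d = \sum_i x i i
      & counit d = q%:R :> k].

(* c ~ d if and only if C_c is contained in K C_d L *)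
Definition coset_rel (K L : {aspace H}) (c d : H) : Prop :=
  exists Cc Cd : {vspace H},
    [/\ subcoalg_of c Cc, subcoalg_of d Cd & (Cc <= K * Cd * L)%VS].

Definition irr_enum n (irr : n.-tuple H) : Prop :=
  uniq irr /\ forall d, d \in irr <-> irr_dual_char d.

(* x |-> a x b; recall that amull u v = u * v and amulr u v = v * u. *)
Definition sandwich (a b : H) : 'End(H) := (amulr b \o amull a)%VF.

Lemma sandwichE a b x : sandwich a b x = a * x * b.
Proof. by rewrite comp_lfunE !lfunE. Qed.

(* As for [mxof], row i lists the coordinates of T e_i. *)
Definition op_mx n (e : n.-tuple H) (T : 'End(H)) : 'M[k]_n :=
  \matrix_(i, j) coord e j (T e`_i).

(* The equivalence classes of coset_rel, as sets of indices in irr. *)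
Definition irr_rel (K L : {aspace H}) n (irr : n.-tuple H) : rel 'I_n :=
  fun i j => `[< coset_rel K L irr`_i irr`_j >].

Definition irr_classes (K L : {aspace H}) n (irr : n.-tuple H) :
    {set {set 'I_n}} :=
  equivalence_partition (irr_rel K L irr) [set: 'I_n].

Definition class_sum n (irr : n.-tuple H) (B : {set 'I_n}) : H :=
  \sum_(i in B) (counit irr`_i : k) *: irr`_i.

End HopfNotions.

Definition principal_eigenvalue (k : numFieldType) n (M : 'M[k]_n) (a : k) :
    Prop :=
  [/\ eigenvalue M a, 0 <= a & forall b, eigenvalue M b -> `|b| <= a].

(* Main.v *)
(* Write T = Lambda_K . Lambda_L.  Once S^2 = 1 is known (Larson-Radford), the
   regular character chi of H is a two-sided integral of H^*, and
   (c, d) |-> chi (S c * d) is a multiple of the form m, for which the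
   irreducible characters are orthonormal.  Lambda_K is the regular character of
   K^*, so T maps characters to characters: its matrix [T] has natural entries, it
   is symmetric since S fixes Lambda_K and Lambda_L, T^2 = |K||L| T, and the
   degrees eps(d) form an eigenvector with eigenvalue |K||L|.  The entry of [T] at
   (c, d) is nonzero exactly when c ~ d, so each class is a connected component
   and the eigenspace is found by a Perron-Frobenius argument.

   Larson-Radford: let L be the integral of H with eps(L) = 1, lam the integral of
   H^* with lam(L) = 1, and w = sum S(L_2) L_1.  Then S^2 is conjugation by w,
   chi(x) = lam(x w) and lam(1) = Tr(S^2).  The modular element g satisfies
   w^2 = w S(w) g with w S(w) central, and g has finite order because group-likes
   are irreducible characters of H^*, which are finite in number.  On an eigenspace
   of w S(w) the trace of w is the dimension, and w is a scalar multiple of a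
   matrix of finite order; this forces the eigenvalue to be positive, whence
   lam(1) > 0.  Now H^* is unimodular, so g = 1 and S^4 = 1, and Tr(S^2) is a
   positive multiple of dim H because chi is dim H times an idempotent of H^*.
   Hence Tr(S^2) = dim H and S^2 = 1. *)
Require Import Defs.
From HB Require Import structures.
From mathcomp Require Import all_boot all_order all_algebra all_field.
From mathcomp Require Import boolp reals complex ring.

Set Implicit Arguments.
Unset Strict Implicit.
Unset Printing Implicit Defensive.

Import Order.TTheory GRing.Theory Num.Theory.
Local Open Scope ring_scope.

(** * Sweedler calculus *)

(* [linear], as a head constant on which the tactic [lin] can match. *)
Definition lin (k : fieldType) (U V : lmodType k) (f : U -> V) : Prop :=
  forall a u v, f (a *: u + v) = a *: f u + f v.

Section Lin.
Variable k : fieldType.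
Implicit Types U V W : vectType k.

Lemma lin_id (U : lmodType k) : lin (fun x : U => x).
Proof. by []. Qed.

Lemma lin_hom (T : lmodType k) U V (f : 'Hom(U, V)) (g : T -> U) :
  lin g -> lin (fun x => f (g x)).
Proof. by move=> lg a u v; rewrite lg linearP. Qed.

Lemma lin_mull (T : lmodType k) (A : falgType k) (c : A) (g : T -> A) :
  lin g -> lin (fun x => c * g x).
Proof. by move=> lg a u v; rewrite lg mulrDr scalerAr. Qed.

Lemma lin_mulr (T : lmodType k) (A : falgType k) (c : A) (g : T -> A) :
  lin g -> lin (fun x => g x * c).
Proof. by move=> lg a u v; rewrite lg mulrDl scalerAl. Qed.

Lemma lin_scalel (T V : lmodType k) (v : V) (g : T -> k^o) :
  lin g -> lin (fun x => (g x : k) *: v).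
Proof. by move=> lg a u w; rewrite lg scalerDl scalerA. Qed.

Lemma lin_scaler (T V : lmodType k) (c : k) (g : T -> V) :
  lin g -> lin (fun x => c *: g x).
Proof. by move=> lg a u w; rewrite lg scalerDr !scalerA mulrC. Qed.

Lemma lin_tensr (T : lmodType k) U V (u : U) (g : T -> V) :
  lin g -> lin (fun x => u ⊗ g x).
Proof.
move=> lg a v w; apply/lfunP => f.
by rewrite add_lfunE scale_lfunE !tensE lg scalerDr !scalerA mulrC.
Qed.

Lemma lin_tlift_par (T : lmodType k) U V W (B : T -> U -> V -> W) (t : tensor U V) :
  (forall a b, lin (fun x => B x a b)) -> lin (fun x => tlift (B x) t).
Proof.
move=> lB a u v; rewrite /tlift scaler_sumr -big_split /=.
by apply: eq_bigr => i _; rewrite lB.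
Qed.

Lemma lin_tlift (T : lmodType k) U V W (B : U -> V -> W) (g : T -> tensor U V) :
  lin g -> (forall a, lin (B a)) -> lin (fun x => tlift B (g x)).
Proof. by move=> lg lB a u v; rewrite lg (tlift_linear (U := U) lB). Qed.

Lemma lin_comp (T V W : lmodType k) (f : V -> W) (g : T -> V) :
  lin f -> lin g -> lin (fun x => f (g x)).
Proof. by move=> lf lg a u v; rewrite lg lf. Qed.

Lemma lin_zero (T V : lmodType k) (f : T -> V) : lin f -> f 0 = 0.
Proof. by move=> lf; have := lf (-1) 0 0; rewrite scaler0 addr0 scaleN1r addNr. Qed.

Lemma linD (T V : lmodType k) (f : T -> V) : lin f -> {morph f : u v / u + v}.
Proof. by move=> lf u v; have := lf 1 u v; rewrite !scale1r. Qed.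

Lemma linZ (T V : lmodType k) (f : T -> V) :
  lin f -> forall a, {morph f : u / a *: u}.
Proof. by move=> lf a u; have := lf a u 0; rewrite !addr0 (lin_zero lf) addr0. Qed.

Lemma lin_sum (T V : lmodType k) (f : T -> V) I (r : seq I) P F : lin f ->
  f (\sum_(i <- r | P i) F i) = \sum_(i <- r | P i) f (F i).
Proof. by move=> lf; rewrite (big_morph f (linD lf) (lin_zero lf)). Qed.

Lemma lin_tliftE U V W W' (F : W -> W') (B : U -> V -> W) t :
  lin F -> F (tlift B t) = tlift (fun a b => F (B a b)) t.
Proof. by move=> lF; rewrite /tlift lin_sum. Qed.

Lemma eq_tlift U V W (B B' : U -> V -> W) t :
  (forall a b, B a b = B' a b) -> tlift B t = tlift B' t.
Proof. by move=> eB; apply: eq_bigr => i _; rewrite eB. Qed.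

Lemma lin_linfunE U V (F : U -> V) : lin F -> linfun F =1 F.
Proof.
move=> lF x; pose m := GRing.isLinear.Build _ _ _ _ _ (lF : linear F).
pose G : {linear U -> V} := HB.pack F m.
by rewrite -[LHS]/(linfun G x) lfunE.
Qed.

End Lin.

Ltac lin1 := match goal with
  | |- forall _, _ => intro
  | |- lin (fun x => x) => apply: lin_id
  | |- @lin ?k ?T ?V (fun x => tlift (@?B x) ?t) =>
      refine (@lin_tlift_par k T _ _ _ B t _)
  | |- @lin ?k ?T ?V (fun x => tlift ?B (@?g x)) => refine (@lin_tlift k T _ _ _ B g _ _)
  | |- @lin ?k ?T ?V (fun x => ?c * @?g x) => refine (@lin_mull k T _ c g _)
  | |- @lin ?k ?T ?V (fun x => @?g x * ?c) => refine (@lin_mulr k T _ c g _)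
  | |- @lin ?k ?T ?V (fun x => ?c *: @?g x) => refine (@lin_scaler k T V c g _)
  | |- @lin ?k ?T ?V (fun x => @?g x *: ?c) => refine (@lin_scalel k T V c g _)
  | |- @lin ?k ?T ?V (fun x => tens ?c (@?g x)) => refine (@lin_tensr k T _ _ c g _)
  | |- @lin ?k ?T ?V (fun x => fun_of_lfun ?f (@?g x)) => refine (@lin_hom k T _ _ f g _)
  | H : forall b, lin (fun x => ?B x b) |- lin (fun x => ?B (@?g x) ?b) =>
      refine (@lin_comp _ _ _ _ (fun z => B z b) g (H b) _)
  | H : forall a, lin (?B a) |- lin (fun x => ?B ?a (@?g x)) =>
      refine (@lin_comp _ _ _ _ (B a) g (H a) _)
  | H : forall b c, lin (fun x => ?B x b c) |- lin (fun x => ?B (@?g x) ?b ?c) =>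
      refine (@lin_comp _ _ _ _ (fun z => B z b c) g (H b c) _)
  | H : forall a c, lin (fun x => ?B a x c) |- lin (fun x => ?B ?a (@?g x) ?c) =>
      refine (@lin_comp _ _ _ _ (fun z => B a z c) g (H a c) _)
  | H : forall a b, lin (?B a b) |- lin (fun x => ?B ?a ?b (@?g x)) =>
      refine (@lin_comp _ _ _ _ (B a b) g (H a b) _)
  | H : lin ?f |- lin (fun x => ?f (@?g x)) =>
      refine (@lin_comp _ _ _ _ f g H _)
  | H : lin ?f |- lin ?f => exact: H
  | H : forall b, lin (?B b) |- lin (?B _) => exact: H
  | H : forall a b, lin (?B a b) |- lin (?B _ _) => exact: H
  | |- lin (fun_of_lfun ?f) => exact: (@lin_hom _ _ _ _ f _ (@lin_id _ _))
  end; cbv beta.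
Ltac lin := solve [repeat lin1; try done].

(* Sweedler notation: [\sw_(a, b <- x) E] is the sum of E over a = x_(1), b = x_(2). *)
Notation "\sw_ ( a , b <- x ) E" := (tlift (fun a b => E) (comul x))
  (at level 36, E at level 36, a name, b name, x at level 50,
   format "'[' \sw_ ( a , b  <-  x ) '/  '  E ']'") : ring_scope.

Section HopfBasics.
Variables (k : fieldType) (H : hopfType k).
Local Notation S := (@antipode k H).
Local Notation eps := (@counit k H).
Implicit Types (x y : H) (W : vectType k).

Section Rules.
Variable W : vectType k.

(** Coassociativity for any trilinear [B]: the map that [B] induces on the triple tensor product is
    applied to [comulA]. *)
Lemma swA (B : H -> H -> H -> W) x :
  (forall b c, lin (fun a => B a b c)) -> (forall a c, lin (fun b => B a b c)) ->
  (forall a b, lin (B a b)) ->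
  \sw_(a, b <- x) (\sw_(c, d <- a) B c d b) = \sw_(a, b <- x) (\sw_(c, d <- b) B a c d).
Proof.
move=> B1 B2 B3; pose G a t := tlift (B a) t.
have lG1 t : lin (G^~ t) by rewrite /G; lin.
have lG2 a : lin (G a) by apply: tlift_linear => u; apply: B3.
have lG : lin (tlift G) by apply: tlift_linear.
have := congr1 (tlift G) (comulA x).
rewrite !(lin_tliftE _ _ lG) => E.
apply: (etrans (etrans _ E)); apply: eq_tlift => a b; last first.
  by rewrite tlift_tens.
rewrite (lin_tliftE _ _ lG); apply: eq_tlift => c d.
by rewrite tlift_tens //; rewrite /G tlift_tens //; [exact: (B2 c) | exact: (B3 c)].
Qed.

Lemma sw_counl (F : H -> W) x : lin F -> \sw_(a, b <- x) ((eps a : k) *: F b) = F x.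
Proof.
move=> lF; rewrite -{2}(counitl x) (lin_tliftE _ _ lF).
by apply: eq_tlift => a b; rewrite linZ.
Qed.

Lemma sw_counr (F : H -> W) x : lin F -> \sw_(a, b <- x) ((eps b : k) *: F a) = F x.
Proof.
move=> lF; rewrite -{2}(counitr x) (lin_tliftE _ _ lF).
by apply: eq_tlift => a b; rewrite linZ.
Qed.

Lemma sw_antil (F : H -> W) x : lin F ->
  \sw_(a, b <- x) F (S a * b) = (eps x : k) *: F 1.
Proof. by move=> lF; rewrite -(lin_tliftE _ _ lF) antipodel linZ. Qed.

Lemma sw_antir (F : H -> W) x : lin F ->
  \sw_(a, b <- x) F (a * S b) = (eps x : k) *: F 1.
Proof. by move=> lF; rewrite -(lin_tliftE _ _ lF) antipoder linZ. Qed.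

Lemma swM (B : H -> H -> W) x y :
  (forall b, lin (fun a => B a b)) -> (forall a, lin (B a)) ->
  \sw_(a, b <- x * y) B a b = \sw_(a, b <- x) (\sw_(c, d <- y) B (a * c) (b * d)).
Proof.
move=> B1 B2; have lB : lin (tlift B) by apply: tlift_linear.
rewrite comulM /tmul (lin_tliftE _ _ lB); apply: eq_tlift => a b.
rewrite (lin_tliftE _ _ lB); apply: eq_tlift => c d.
by rewrite tlift_tens //; apply: B1.
Qed.

Lemma sw1 (B : H -> H -> W) :
  (forall b, lin (fun a => B a b)) -> (forall a, lin (B a)) ->
  \sw_(a, b <- 1) B a b = B 1 1.
Proof. by move=> B1 B2; rewrite comul1 tlift_tens //; apply: B1. Qed.

Lemma sw_exchange (B : H -> H -> H -> H -> W) x y :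
  \sw_(a, b <- x) (\sw_(c, d <- y) B a b c d) = \sw_(c, d <- y) (\sw_(a, b <- x) B a b c d).
Proof. exact: exchange_big. Qed.

Section Bil.
Variable B : H -> H -> W.
Hypotheses (B1 : forall b, lin (fun a => B a b)) (B2 : forall a, lin (B a)).

(** In this and the next three lemmas the first suffix letter tells on which factor of the
    cancelling pair [S] sits, the second at which end of the triple coproduct the pair stands. *)
Lemma sw_antill x :
  \sw_(a, b <- x) (\sw_(c, d <- b) B (S a * c) d) = B 1 x.
Proof.
rewrite -(@swA (fun a b c => B (S a * b) c)); try lin.
rewrite -[RHS](@sw_counl (B 1)); try lin.
by apply: eq_tlift => a b; rewrite (@sw_antil (B^~ b)) //; apply: B1.
Qed.

Lemma sw_antirl x :
  \sw_(a, b <- x) (\sw_(c, d <- b) B (a * S c) d) = B 1 x.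
Proof.
rewrite -(@swA (fun a b c => B (a * S b) c)); try lin.
rewrite -[RHS](@sw_counl (B 1)); try lin.
by apply: eq_tlift => a b; rewrite (@sw_antir (B^~ b)) //; apply: B1.
Qed.

Lemma sw_antilr x :
  \sw_(a, b <- x) (\sw_(c, d <- b) B a (S c * d)) = B x 1.
Proof.
rewrite -[RHS](@sw_counr (B^~ 1)); try lin.
by apply: eq_tlift => a b; rewrite (@sw_antil (B a)) //; apply: B2.
Qed.

Lemma sw_antirr x :
  \sw_(a, b <- x) (\sw_(c, d <- b) B a (c * S d)) = B x 1.
Proof.
rewrite -[RHS](@sw_counr (B^~ 1)); try lin.
by apply: eq_tlift => a b; rewrite (@sw_antir (B a)) //; apply: B2.
Qed.

End Bil.
End Rules.

Lemma antipode1 : S 1 = 1.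
Proof.
have := antipodel (1 : H); rewrite (@sw1 _ (fun a b => S a * b)); [|by lin|by lin].
by rewrite mulr1 counit1 scale1r.
Qed.

Lemma counit_antipode x : eps (S x) = eps x.
Proof.
have lS : lin (fun a => eps (S a)) by lin.
rewrite -(sw_counr x lS) -[RHS]mulr1 -(counit1 (s := H)).
rewrite -[RHS]/((eps x : k) *: eps 1) -(@sw_antil _ eps); last lin.
by apply: eq_tlift => a b; rewrite counitM /GRing.scale /= mulrC.
Qed.

(** In the convolution algebra of maps from H ⊗ H to H, the left side is a left inverse of the
    multiplication and the right side a right inverse; [E] is the triple convolution, contracted at
    either end. *)
Lemma antipodeM x y : S (x * y) = S y * S x.
Proof.
pose G a b1 b2 c d1 d2 := S (a * c) * (b1 * d1) * (S d2 * S b2).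
pose E := \sw_(a, b <- x) (\sw_(b1, b2 <- b) (\sw_(c, d <- y) (\sw_(d1, d2 <- d)
   G a b1 b2 c d1 d2))).
transitivity E.
  transitivity (\sw_(a, b <- x) (\sw_(c, d <- y) ((eps b : k) *: ((eps d : k) *: S (a * c))))).
    transitivity (\sw_(a, b <- x) ((eps b : k) *: S (a * y))).
      by rewrite sw_counr; lin.
    apply: eq_tlift => a b; rewrite -(@lin_tliftE _ _ _ _ _ (fun z => (eps b : k) *: z)); last lin.
    by rewrite (@sw_counr _ (fun c => S (a * c))); lin.
  apply: eq_tlift => a b; rewrite [RHS]sw_exchange; apply: eq_tlift => c d.
  transitivity (\sw_(b1, b2 <- b) ((eps d : k) *: (S (a * c) * (b1 * S b2)))).
    rewrite (@sw_antir _ (fun z => (eps d : k) *: (S (a * c) * z))); last lin.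
    by rewrite mulr1.
  apply: eq_tlift => b1 b2.
  transitivity (\sw_(d1, d2 <- d) (S (a * c) * (b1 * (d1 * S d2) * S b2))).
    by rewrite (@sw_antir _ (fun z => S (a * c) * (b1 * z * S b2))) ?mulr1; lin.
  by apply: eq_tlift => d1 d2; rewrite /G !mulrA.
rewrite /E -(@swA _ (fun a b1 b2 => \sw_(c, d <- y) (\sw_(d1, d2 <- d) G a b1 b2 c d1 d2)));
  rewrite /G; try lin.
transitivity (\sw_(p, b <- x) (\sw_(q, d <- y) ((eps p : k) *: ((eps q : k) *: (S d * S b))))).
  apply: eq_tlift => p b.
  rewrite -/(G _ _ b _ _ _).
  transitivity (\sw_(a, b1 <- p) (\sw_(q, d <- y) (\sw_(c, d1 <- q) G a b1 b c d1 d))).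
    by apply: eq_tlift => a b1; rewrite -swA // /G; lin.
  rewrite sw_exchange; apply: eq_tlift => q d.
  rewrite /G -(@swM _ (fun u v => S u * v * (S d * S b))); try lin.
  rewrite (@sw_antil _ (fun z => z * (S d * S b))); last lin.
  by rewrite counitM scalerA mul1r.
rewrite -[RHS](@sw_counl _ (fun b => S y * S b)); last lin.
apply: eq_tlift => p b.
rewrite -(@lin_tliftE _ _ _ _ _ (fun z => (eps p : k) *: z)); last lin.
by rewrite (@sw_counl _ (fun d => S d * S b)); lin.
Qed.

(** Again uniqueness of a convolution inverse, now of the comultiplication among maps from H to H ⊗
    H; [Z] multiplies by S(s_2) ⊗ S(s_1) and then applies [B]. *)
Lemma sw_antipode W (B : H -> H -> W) x :
  (forall b, lin (fun a => B a b)) -> (forall a, lin (B a)) ->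
  \sw_(a, b <- S x) B a b = \sw_(a, b <- x) B (S b) (S a).
Proof.
move=> B1 B2.
pose Z u v s := \sw_(c, d <- s) B (u * S d) (v * S c).
have Z1 v s : lin (fun u => Z u v s) by rewrite /Z; lin.
have Z2 u s : lin (fun v => Z u v s) by rewrite /Z; lin.
have Z3 u v : lin (Z u v) by rewrite /Z; lin.
transitivity (\sw_(p, q <- x) (\sw_(r, s <- q) (\sw_(u, v <- S p * r) Z u v s))).
  transitivity (\sw_(p, q <- x) ((eps q : k) *: (\sw_(u, v <- S p) B u v))).
    by rewrite (@sw_counr _ (fun p => \sw_(u, v <- S p) B u v)); lin.
  apply: eq_tlift => p q.
  transitivity (\sw_(u, v <- S p) (\sw_(r, s <- q) (\sw_(c, d <- r) Z (u * c) (v * d) s))); last first.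
    rewrite sw_exchange; apply: eq_tlift => r s.
    by rewrite -(@swM _ (fun u v => Z u v s)); lin.
  rewrite (@lin_tliftE _ _ _ _ _ (fun z => (eps q : k) *: z)); last lin.
  apply: eq_tlift => u v.
  rewrite (@swA _ (fun c d s => Z (u * c) (v * d) s)); try lin.
  transitivity (\sw_(a, b <- q) B (u * (a * S b)) v).
    by rewrite (@sw_antir _ (fun z => B (u * z) v)) ?mulr1; lin.
  apply: eq_tlift => a b.
  rewrite -[RHS](_ : \sw_(c, d <- b) (\sw_(e, f <- d) B (u * (a * S f)) (v * (c * S e))) = _).
    by rewrite (@sw_antirl _ (fun z f => B (u * (a * S f)) (v * z))) ?mulr1; lin.
  by apply: eq_tlift => c d; apply: eq_tlift => e f; rewrite !mulrA.
rewrite -(@swA _ (fun p r s => \sw_(u, v <- S p * r) Z u v s)); try lin.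
transitivity (\sw_(p, q <- x) ((eps p : k) *: Z 1 1 q)).
  apply: eq_tlift => p q.
  rewrite (@sw_antil _ (fun z => \sw_(u, v <- z) Z u v q)); last lin.
  by rewrite sw1; lin.
rewrite (@sw_counl _ (Z 1 1)) /Z; last lin.
by apply: eq_tlift => a b; rewrite !mul1r.
Qed.

End HopfBasics.

(** * Traces and left ideals *)

Section Trace.
Variables (k : fieldType) (V : vectType k).
Implicit Types U : {vspace V}.

(** The trace of [X] on [U], meaningful when [X] maps [U] to itself; off [U] the coordinates carry
    no information. *)
Definition trv U (X : V -> V) : k :=
  \sum_(i < \dim U) coord (vbasis U) i (X (vbasis U)`_i).

Lemma eq_trv U X Y : {in U, X =1 Y} -> trv U X = trv U Y.
Proof.
move=> eXY; apply: eq_bigr => i _; rewrite eXY //.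
by rewrite vbasis_mem // mem_nth ?size_tuple.
Qed.

(** Serves to compute traces from the dual systems that integrals produce: any expression by
    rank-one maps with values in [U] will do. *)
Lemma trv_rank1 U X (I : finType) (phi : I -> V -> k^o) (u : I -> V) :
  (forall i, lin (phi i)) -> (forall i, u i \in U) ->
  {in U, forall y, X y = \sum_i (phi i y : k) *: u i} ->
  trv U X = \sum_i phi i (u i).
Proof.
move=> lphi uU eX; rewrite /trv.
under eq_bigr => i _.
  rewrite eX ?vbasis_mem ?mem_nth ?size_tuple // linear_sum.
  under eq_bigr do rewrite linearZ.
  over.
rewrite exchange_big; apply: eq_bigr => j _ /=.
rewrite {2}(coord_vbasis (uU j)) lin_sum //; apply: eq_bigr => i _.
by rewrite linZ // mulrC.
Qed.

Lemma trvD U X Y : trv U (fun y => X y + Y y) = trv U X + trv U Y.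
Proof. by rewrite -big_split; apply: eq_bigr => i _; rewrite linearD. Qed.

Lemma trvZ U a X : trv U (fun y => a *: X y) = a * trv U X.
Proof. by rewrite mulr_sumr; apply: eq_bigr => i _; rewrite linearZ. Qed.

Lemma trv_id U : trv U id = (\dim U)%:R.
Proof.
rewrite /trv -[in RHS](card_ord (\dim U)) -sumr_const; apply: eq_bigr => i _.
by rewrite coord_free ?eqxx // (basis_free (vbasisP U)).
Qed.

Lemma trv_comp X Y : lin X -> lin Y -> trv fullv (X \o Y) = trv fullv (Y \o X).
Proof.
move=> lX lY.
rewrite (@trv_rank1 _ (X \o Y) _ (fun i y => coord (vbasis fullv) i (Y y))
  (fun i => X (vbasis {: V})`_i)) //= => [i|i|y _].
- by move=> a u v; rewrite lY linearP.
- exact: memvf.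
by rewrite {1}(coord_vbasis (memvf (Y y))) lin_sum //; apply: eq_bigr => i _; rewrite linZ.
Qed.

Lemma trv_idem (X : 'End(V)) : (forall y, X (X y) = X y) ->
  trv fullv X = (\dim (limg X))%:R.
Proof.
move=> XX; have Xid y : y \in limg X -> X y = y by case/memv_imgP => z _ ->.
rewrite (@trv_rank1 _ _ _ (fun i y => coord (vbasis (limg X)) i (X y))
  (fun i => (vbasis (limg X))`_i)) => [|i|i|y _].
- rewrite -trv_id; apply: eq_bigr => i _.
  by rewrite Xid // vbasis_mem // mem_nth ?size_tuple.
- by move=> a u v; rewrite !linearP.
- exact: memvf.
by rewrite -coord_vbasis // memv_img ?memvf.
Qed.

End Trace.

Lemma trv_idem_eq0 (k : numFieldType) (V : vectType k) (X : 'End(V)) :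
  (forall y, X (X y) = X y) -> trv fullv X = 0 -> X = 0.
Proof.
move=> XX; rewrite trv_idem // => /eqP.
rewrite pnatr_eq0 dimv_eq0 => /eqP X0.
by apply/lfunP => y; rewrite lfunE /=; apply/eqP; rewrite -memv0 -X0 memv_img ?memvf.
Qed.

Section LeftIdeals.
Variables (k : fieldType) (A : falgType k).
Hypothesis ssA : semisimple A.

Lemma left_idealP (I : {vspace A}) :
  reflect (forall x y, y \in I -> x * y \in I) (left_ideal I).
Proof.
apply: (iffP idP) => [/subvP li x y yI|li]; first by apply/li/memv_mul; rewrite ?memvf.
by apply/prodvP => x y _; apply: li.
Qed.

(** [e] is the component of 1 in [I] along a complementary left ideal [J]: y - y e lies in both [I]
    and [J]. *)
Lemma left_ideal_idem (I : {vspace A}) : left_ideal I ->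
  exists e, [/\ e \in I, e * e = e & forall y, y \in I -> y * e = y].
Proof.
move=> lI; have [J [lJ IJ1 IJ0]] := ssA lI.
have: 1 \in (I + J)%VS by rewrite IJ1 memvf.
case/memv_addP => e eI [f fJ ef].
have ye y : y \in I -> y * e = y.
  move=> yI; have yf0 : y * f = 0.
    apply/eqP; rewrite -memv0 -IJ0 memv_cap (left_idealP _ lJ) // andbT.
    have -> : y * f = y - y * e by rewrite -[X in X - _]mulr1 ef mulrDr addrAC subrr add0r.
    by rewrite memvB // (left_idealP _ lI).
  by rewrite -[RHS]mulr1 ef mulrDr yf0 addr0.
by exists e; split=> //; apply: ye.
Qed.

End LeftIdeals.

(** * Integrals and the Frobenius form *)

Section Integrals.
Variables (k : fieldType) (H : hopfType k).
Local Notation S := (@antipode k H).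
Local Notation eps := (@counit k H).
Implicit Types (x y : H).

(** A tensor being a map on functionals, [comul x f] is the sum of f(x_1) x_2, that is the right
    action of [f] in H^* on [x]. *)
Lemma comulE (U V : vectType k) (t : tensor U V) (f : 'Hom(U, k^o)) :
  t f = tlift (fun a b => (f a : k) *: b) t.
Proof.
by rewrite {1}(tens_span t) sum_lfunE; apply: eq_bigr => i _; rewrite tensE.
Qed.

(** Lets an identity valid for elements of a Hopf subalgebra be used under a Sweedler sum, since the
    comultiplication stays inside. *)
Lemma eq_tlift_in (U V W : vectType k) (A : {vspace U}) (B : {vspace V})
    (F G : U -> V -> W) t :
  (forall b, lin (F^~ b)) -> (forall a, lin (F a)) ->
  (forall b, lin (G^~ b)) -> (forall a, lin (G a)) ->
  {in A & B, forall a b, F a b = G a b} -> t \in tensv A B ->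
  tlift F t = tlift G t.
Proof.
move=> F1 F2 G1 G2 eFG tAB; apply/eqP; rewrite -subr_eq0; apply/eqP.
have lF := tlift_linear F2; have lG := tlift_linear G2.
pose D := linfun (fun t => tlift F t - tlift G t).
have DE s : D s = tlift F s - tlift G s.
  by rewrite lin_linfunE // => a u v; rewrite lF lG scalerBr opprD addrACA.
rewrite -DE; apply/eqP; rewrite -memv_ker; move: t tAB; apply/subvP.
apply/span_subvP => _ /allpairsP[[a b] /= [aA bB ->]].
rewrite memv_ker DE !tlift_tens // eFG ?subrr //; exact: vbasis_mem.
Qed.

Lemma tensv_comul (A B : {vspace H}) (t : tensor H H) (f : 'Hom(H, k^o)) :
  t \in tensv A B -> t f \in B.
Proof.
pose D : 'Hom(tensor H H, H) := linfun (fun t : tensor H H => t f).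
have DE (s : tensor H H) : D s = s f.
  by rewrite lin_linfunE // => a u v; rewrite add_lfunE scale_lfunE.
rewrite -DE memv_preim; move: t; apply/subvP/span_subvP => _ /allpairsP[[a b] /= [aA bB ->]].
by rewrite -memv_preim DE tensE memvZ // vbasis_mem.
Qed.

Lemma tensvf (t : tensor H H) : t \in tensv fullv fullv.
Proof.
rewrite (tens_span t); apply: memv_suml => i _.
rewrite {1}(coord_vbasis (memvf (t _))).
have lt : lin (fun v : H => (vbasis {:H})`_i ⊗ v) by lin.
rewrite (@lin_sum _ _ _ _ _ _ _ _ lt); apply: memv_suml => j _; rewrite (linZ lt) memvZ //.
by apply/memv_span/allpairsP; exists ((vbasis {:H})`_i, (vbasis {:H})`_j);
  rewrite !mem_nth ?size_tuple.
Qed.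

Section Casimir.
Variables (W : vectType k) (B : H -> H -> W).
Hypotheses (B1 : forall b, lin (fun a => B a b)) (B2 : forall a, lin (B a)).

(** The Casimir property of L_1 ⊗ S(L_2): expand x as eps(x_1) x_2, replace eps(x_1) L by x_1 L, and
    cancel S(x_2) against x_3. *)
Lemma casimir (K : {vspace H}) L x :
  (forall y, y \in K -> comul y \in tensv K K) ->
  (forall y, y \in K -> y * L = (eps y : k) *: L) -> x \in K ->
  \sw_(a, b <- L) B (x * a) (S b) = \sw_(a, b <- L) B a (S b * x).
Proof.
move=> KK intL xK; apply/esym.
transitivity (\sw_(p, q <- x) ((eps p : k) *: \sw_(a, b <- L) B a (S b * q))).
  by rewrite (@sw_counl _ _ _ (fun q => \sw_(a, b <- L) B a (S b * q))); lin.
transitivity (\sw_(p, q <- x) (\sw_(a, b <- p * L) B a (S b * q))).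
  apply: (@eq_tlift_in _ _ _ K K); try lin; last exact: KK.
  move=> p q pK _ /=; rewrite intL // (@linZ _ _ _ (fun z => \sw_(a, b <- z) B a (S b * q))) //.
  by lin.
transitivity (\sw_(p, q <- x) (\sw_(r, s <- p) (\sw_(a, b <- L) B (r * a) (S (s * b) * q)))).
  by apply: eq_tlift => p q; rewrite (@swM _ _ _ (fun a b => B a (S b * q))); lin.
rewrite (@swA _ _ _ (fun r s q => \sw_(a, b <- L) B (r * a) (S (s * b) * q))); try lin.
transitivity (\sw_(a, b <- L) (\sw_(r, s <- x) (\sw_(p, q <- s) B (r * a) (S b * (S p * q))))).
  rewrite sw_exchange; apply: eq_tlift => r s.
  rewrite sw_exchange; apply: eq_tlift => p q.
  by apply: eq_tlift => a b; rewrite antipodeM mulrA.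
apply: eq_tlift => a b.
by rewrite (@sw_antilr _ _ _ (fun r z => B (r * a) (S b * z))) ?mulr1; lin.
Qed.

Variable L : H.
Hypothesis intl : forall y, y * L = (eps y : k) *: L.
Hypothesis intr : forall y, L * y = (eps y : k) *: L.

(** Insert S(x_1) x_2 before L_1: then x_2 and x_3 together multiply L, which absorbs them. *)
Lemma integral_left x : \sw_(a, b <- L) B a (x * b) = \sw_(a, b <- L) B (S x * a) b.
Proof.
transitivity (\sw_(p, q <- x) (\sw_(a, b <- q * L) B (S p * a) b)).
  transitivity (\sw_(a, b <- L) (\sw_(p, q <- x) (\sw_(r, s <- q) B (S p * r * a) (s * b)))).
    apply: eq_tlift => a b.
    by rewrite (@sw_antill _ _ _ (fun z s => B (z * a) (s * b))) ?mul1r; lin.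
  rewrite sw_exchange; apply: eq_tlift => p q.
  rewrite (@swM _ _ _ (fun a b => B (S p * a) b)); try lin.
  rewrite sw_exchange; apply: eq_tlift => r s.
  by apply: eq_tlift => a b; rewrite mulrA.
rewrite -(@sw_counr _ _ _ (fun p => \sw_(a, b <- L) B (S p * a) b)); last lin.
apply: eq_tlift => p q; rewrite intl (@linZ _ _ _ (fun z => \sw_(a, b <- z) B (S p * a) b)) //.
by lin.
Qed.

Lemma integral_right x : \sw_(a, b <- L) B (a * x) b = \sw_(a, b <- L) B a (b * S x).
Proof.
transitivity (\sw_(p, q <- x) (\sw_(a, b <- L * p) B a (b * S q))).
  transitivity (\sw_(a, b <- L) (\sw_(p, q <- x) (\sw_(r, s <- q) B (a * p) (b * (r * S s))))).
    apply: eq_tlift => a b.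
    by rewrite (@sw_antirr _ _ _ (fun p z => B (a * p) (b * z))) ?mulr1; lin.
  transitivity (\sw_(p, q <- x) (\sw_(r, s <- p) (\sw_(a, b <- L) B (a * r) (b * s * S q)))); last first.
    apply: eq_tlift => p q.
    rewrite (@swM _ _ _ (fun a b => B a (b * S q))); try lin.
    by rewrite sw_exchange.
  rewrite (@swA _ _ _ (fun r s q => \sw_(a, b <- L) B (a * r) (b * s * S q))); try lin.
  rewrite sw_exchange; apply: eq_tlift => p q.
  rewrite sw_exchange; apply: eq_tlift => r s.
  by apply: eq_tlift => a b; rewrite mulrA.
rewrite -(@sw_counl _ _ _ (fun q => \sw_(a, b <- L) B a (b * S q))); last lin.
apply: eq_tlift => p q; rewrite intr (@linZ _ _ _ (fun z => \sw_(a, b <- z) B a (b * S q))) //.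
by lin.
Qed.

End Casimir.

(** The component of 1 in a left ideal complementary to the kernel of eps is a left integral with
    counit 1. *)
Lemma semisimple_integral : semisimple H ->
  exists L, [/\ forall y, y * L = (eps y : k) *: L,
                forall y, L * y = (eps y : k) *: L & eps L = 1 :> k].
Proof.
move=> ssH; have lI : left_ideal (lker eps).
  apply/left_idealP => x y; rewrite !memv_ker => /eqP y0.
  by rewrite counitM y0 mulr0.
have [J [lJ IJ1 IJ0]] := ssH _ lI.
have: 1 \in (lker eps + J)%VS by rewrite IJ1 memvf.
case/memv_addP => i iI [L LJ eL].
have eL1 : eps L = 1 :> k.
  by rewrite -(counit1 (s := H)) eL linearD /= (eqP (_ : eps i == 0)) ?add0r // -memv_ker.
have intl y : y * L = (eps y : k) *: L.
  apply/eqP; rewrite -subr_eq0 -memv0 -IJ0 memv_cap memv_ker linearB linearZ /=.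
  rewrite counitM eL1 mulr1 /GRing.scale /= mulr1 subrr eqxx /=.
  by rewrite memvB ?memvZ // (left_idealP _ lJ).
exists L; split=> // y.
(* [s] is a left integral of counit 0, so s s = 0; a right unit [e] of the left ideal spanned by [s]
   is a multiple of [s], which forces s = s e = 0. *)
set s := L * y - (eps y : k) *: L.
have intls z : z * s = (eps z : k) *: s.
  by rewrite mulrBr mulrA intl -scalerAl -scalerAr intl scalerBr !scalerA mulrC.
have eps_s : eps s = 0 :> k.
  by rewrite linearB linearZ /= counitM eL1 mul1r /GRing.scale /= mulr1 subrr.
have [|e [es ee ye]] := left_ideal_idem ssH (_ : left_ideal <[s]>).
  apply/left_idealP => z _ /vlineP[c ->].
  by rewrite -scalerAr intls scalerA memvZ // memv_line.
apply/eqP; rewrite -subr_eq0 -/s -(ye s (memv_line s)).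
have /vlineP[c ->] := es.
by rewrite -scalerAr intls eps_s scale0r scaler0.
Qed.

End Integrals.

Section Functionals.
Variables (k : fieldType) (V : vectType k).

Lemma functional_eq (x y : V) : (forall u : 'Hom(V, k^o), u x = u y) -> x = y.
Proof.
move=> exy; rewrite (coord_vbasis (memvf x)) (coord_vbasis (memvf y)).
by apply: eq_bigr => i _; rewrite -!dual_basisE exy.
Qed.

End Functionals.

Section Frobenius.
Variables (k : fieldType) (H : hopfType k).
Local Notation S := (@antipode k H).
Local Notation eps := (@counit k H).
Implicit Types (x y : H) (f g u : 'Hom(H, k^o)).

Lemma conv_sw f g x : conv f g x = \sw_(a, b <- x) ((f a : k) *: g b).
Proof. exact: convE. Qed.

Lemma comul_conv x f g : comul x (conv f g) = comul (comul x f) g.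
Proof.
rewrite !comulE.
transitivity (\sw_(a, b <- x) (\sw_(c, d <- a) ((f c : k) *: ((g d : k) *: b)))).
  apply: eq_tlift => a b; rewrite conv_sw.
  rewrite (@lin_tliftE _ _ _ _ _ (fun z : k^o => (z : k) *: b)); last lin.
  by apply: eq_tlift => c d; rewrite scalerA.
rewrite (@swA _ _ _ (fun c d b => (f c : k) *: ((g d : k) *: b))); try lin.
rewrite (@lin_tliftE _ _ _ _ _ (fun z => \sw_(c, d <- z) ((g c : k) *: d))); last lin.
apply: eq_tlift => c d.
rewrite (@linZ _ _ _ (fun z => \sw_(c, d <- z) ((g c : k) *: d))); last lin.
by rewrite (@lin_tliftE _ _ _ _ _ (fun z => (f c : k) *: z)); lin.
Qed.

Lemma counit_comul x f : eps (comul x f) = f x.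
Proof.
rewrite comulE (@lin_tliftE _ _ _ _ _ eps); last lin.
rewrite -[RHS](@sw_counr _ _ _ f); last lin.
by apply: eq_tlift => a b; rewrite linearZ /= /GRing.scale /= mulrC.
Qed.

Lemma convE_comul f g x : conv f g x = g (comul x f).
Proof. by rewrite -counit_comul comul_conv counit_comul. Qed.

Variable L : H.
Hypotheses (intl : forall y, y * L = (eps y : k) *: L)
  (intr : forall y, L * y = (eps y : k) *: L) (epsL : eps L = 1 :> k).

(* [comul L], an element of Hom(H^*, H), is the map f |-> sum f(L_1) L_2. *)
Lemma comul_int_limg : limg (comul L) = fullv.
Proof.
have mulL x f : x * comul L f = comul L (f \o amull (S x))%VF.
  rewrite !comulE (@lin_tliftE _ _ _ _ _ (fun z => x * z)); last lin.
  transitivity (\sw_(a, b <- L) ((f a : k) *: (x * b))).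
    by apply: eq_tlift => a b; rewrite scalerAr.
  rewrite (@integral_left _ _ _ (fun a b => (f a : k) *: b)) //; try lin.
  by apply: eq_tlift => a b; rewrite comp_lfunE lfunE.
apply/vspaceP => x; rewrite memvf.
(* By [mulL] the image is a left ideal, and it contains the sum of S(L_1) L_2, which is eps(L) =
   1. *)
have := antipodel L; rewrite epsL scale1r => e1.
rewrite -[x]mulr1 -e1 (@lin_tliftE _ _ _ _ _ (fun z => x * z)); last lin.
by apply: memv_suml => i _; rewrite mulrA mulL memv_img ?memvf.
Qed.

Lemma comul_int_inj f : comul L f = 0 -> f = 0.
Proof.
move=> f0; have /eqP := limg_ker_dim (comul L) fullv.
rewrite capfv comul_int_limg !dimvf.
have -> : dim 'Hom(H, k^o) = dim H by rewrite /dim /= muln1.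
rewrite -[X in _ == X]add0n eqn_add2r dimv_eq0 => /eqP k0.
by apply/eqP; rewrite -memv0 -k0 memv_ker f0.
Qed.

Lemma dual_integral_exists : exists l, comul L l = 1.
Proof.
have: 1 \in limg (comul L) by rewrite comul_int_limg memvf.
by case/memv_imgP => l _ ->; exists l.
Qed.

(** Writing 1 as the sum of f(L_1) L_2, [integral_left] gives x as the sum of f(S(x) L_1) L_2. *)
Lemma antipode_inj x : S x = 0 -> x = 0.
Proof.
move=> Sx0; have: 1 \in limg (comul L) by rewrite comul_int_limg memvf.
case/memv_imgP => f _ e1; rewrite -[x]mulr1 e1 comulE.
rewrite (@lin_tliftE _ _ _ _ _ (fun z => x * z)); last lin.
transitivity (\sw_(a, b <- L) ((f a : k) *: (x * b))).
  by apply: eq_tlift => a b; rewrite scalerAr.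
rewrite (@integral_left _ _ _ (fun a b => (f a : k) *: b)) //; try lin.
by rewrite Sx0 /tlift big1 // => i _; rewrite mul0r linear0 scale0r.
Qed.

Lemma antipode_surj y : exists x, y = S x.
Proof.
have: y \in limg S.
  suff -> : limg S = fullv by rewrite memvf.
  apply/eqP; rewrite eqEdim subvf /= limg_dim_eq //.
  rewrite capfv; apply/eqP; rewrite -subv0; apply/subvP => x.
  by rewrite memv_ker memv0 => /eqP /antipode_inj ->.
by case/memv_imgP => x _ ->; exists x.
Qed.

(** As S is surjective, S(L) is a left integral; hence L S(L) equals both S(L) and L. *)
Lemma antipode_int : S L = L.
Proof.
have intSl y : y * S L = (eps y : k) *: S L.
  have [x ->] := antipode_surj y.
  by rewrite -antipodeM intr linearZ counit_antipode.
by rewrite -[LHS]scale1r -epsL -intSl intr counit_antipode epsL scale1r.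
Qed.

Lemma sw_antipode_int (W : vectType k) (B : H -> H -> W) :
  (forall b, lin (fun a => B a b)) -> (forall a, lin (B a)) ->
  \sw_(a, b <- L) B (S b) (S a) = \sw_(a, b <- L) B a b.
Proof. by move=> B1 B2; rewrite -[in RHS]antipode_int sw_antipode. Qed.

Section Form.
Variable lam : 'Hom(H, k^o).
Hypothesis lamL : comul L lam = 1.

Lemma lam_int : lam L = 1 :> k.
Proof. by rewrite -counit_comul lamL counit1. Qed.

(** Both sides send L to u(1) 1, and the map [comul L] is injective. *)
Lemma conv_lam u : conv lam u = (u 1 : k) *: lam.
Proof.
apply/eqP; rewrite -subr_eq0; apply/eqP/comul_int_inj.
rewrite linearB linearZ /= lamL comul_conv lamL.
by rewrite comulE sw1 ?subrr //; lin.
Qed.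

Lemma sw_lam (W : vectType k) (F : H -> W) x : lin F ->
  \sw_(a, b <- x) ((lam a : k) *: F b) = (lam x : k) *: F 1.
Proof.
move=> lF; apply: functional_eq => u.
pose v := linfun (fun z => u (F z)).
have vE z : v z = u (F z) by rewrite lin_linfunE //; lin.
rewrite linearZ /= -vE.
transitivity (conv lam v x); last by rewrite conv_lam scale_lfunE /GRing.scale /= mulrC.
rewrite conv_sw (@lin_tliftE _ _ _ _ _ u); last lin.
by apply: eq_tlift => a b; rewrite linearZ vE.
Qed.

Lemma lam_unique f : (forall u, conv f u = (u 1 : k) *: f) -> f = (f L : k) *: lam.
Proof.
move=> intf; apply/eqP; rewrite -subr_eq0; apply/eqP/comul_int_inj.
rewrite linearB linearZ /= lamL; apply/eqP; rewrite subr_eq0; apply/eqP.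
apply: functional_eq => u; rewrite -convE_comul intf.
by rewrite scale_lfunE linearZ /= /GRing.scale /= mulrC.
Qed.

(** L_1 and S(L_2) are dual bases for lam: the Casimir property moves x to the right, and the sum of
    lam(L_1) S(L_2) is S(1). *)
Lemma lam_dual_basis (W : vectType k) (F : H -> W) x : lin F ->
  \sw_(a, b <- L) ((lam (x * a) : k) *: F (S b)) = F x.
Proof.
move=> lF; rewrite (@casimir _ _ _ (fun a b => (lam a : k) *: F b) _ _ fullv) //;
  try lin; [|by move=> y _; apply: tensvf|exact: memvf].
rewrite -[in RHS](mul1r x) -antipode1 -lamL comulE.
rewrite (@lin_tliftE _ _ _ _ _ (fun z => F (S z * x))); last lin.
by apply: eq_tlift => a b; rewrite linearZ -scalerAl (linZ lF).
Qed.

Lemma trace_lam (X : H -> H) : lin X ->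
  trv fullv X = \sw_(a, b <- L) (lam (X (S b) * a)).
Proof.
move=> lX; rewrite (@trv_rank1 _ _ _ _ 'I_(\dim {:H}) (fun i y => lam (y * (vbasis {:H})`_i))
  (fun i => X (S (comul L (dual_basis i))))) //.
- by move=> i; lin.
- by move=> i; apply: memvf.
- by move=> y _; rewrite -(@lam_dual_basis _ X y).
Qed.

End Form.
End Frobenius.

(** * The theorem of Larson and Radford *)

Section Matrices.

Lemma trig_mul_diag (k : fieldType) n (A B : 'M[k]_n) i :
  is_trig_mx A -> is_trig_mx B -> (A *m B) i i = A i i * B i i.
Proof.
move=> /is_trig_mxP tA /is_trig_mxP tB; rewrite mxE (bigD1 i) //= big1 ?addr0 // => j ji.
have [ij|ij|/val_inj eij] := ltngtP i j; last by rewrite eij eqxx in ji.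
  by rewrite tA ?mul0r.
by rewrite tB ?mulr0.
Qed.

Lemma trig_mul (k : fieldType) n (A B : 'M[k]_n) :
  is_trig_mx A -> is_trig_mx B -> is_trig_mx (A *m B).
Proof.
move=> /is_trig_mxP tA /is_trig_mxP tB; apply/is_trig_mxP => i j ij.
rewrite mxE big1 // => s _; have [si|si] := leqP s i; last by rewrite tA ?mul0r.
by rewrite tB ?mulr0 // (leq_ltn_trans si).
Qed.

(** Commuting matrices are made triangular together; the eigenvalues of A are roots of unity, whose
    inverses are their conjugates. *)
Lemma finite_order_trace (k : numClosedFieldType) n (A B : 'M[k]_n) m :
  (0 < m)%N -> A *m B = 1%:M -> A ^+ m = 1%:M -> \tr B = (\tr A)^*.
Proof.
move=> m0 AB Am.
have AC : A *m B = B *m A by rewrite AB (mulmx1C AB).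
have [P uP /andP[]] := cotrigonalization2 AC.
have {}uP := unitarymx_unit uP.
rewrite /similar_to !conjumx // => tA tB.
have trP M : \tr M = \tr (P *m M *m invmx P).
  by rewrite mxtrace_mulC mulmxA mulVmx // mul1mx.
rewrite (trP A) (trP B); set A' := P *m A *m _ in tA *; set B' := P *m B *m _ in tB *.
have A'm i : A' i i ^+ m = 1.
  have -> : A' i i ^+ m = (P *m A ^+ m *m invmx P) i i.
    suff [_ ->] : is_trig_mx (P *m A ^+ m *m invmx P) /\
      (P *m A ^+ m *m invmx P) i i = A' i i ^+ m by [].
    elim: m {m0 Am} => [|m [IH1 IH2]].
      rewrite expr0 mulmx1 mulmxV // expr0 mxE eqxx; split=> //.
    have -> : P *m A ^+ m.+1 *m invmx P = A' *m (P *m A ^+ m *m invmx P).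
      by rewrite exprS /A' !mulmxA mulmxKV.
    by rewrite trig_mul // trig_mul_diag // IH2 exprS.
  by rewrite Am mulmx1 mulmxV // mxE eqxx.
rewrite rmorph_sum; apply: eq_bigr => i _.
have nA : `|A' i i| = 1.
  by apply/eqP; rewrite -(pexpr_eq1 m0) ?normr_ge0 // -normrX A'm normr1.
have ABi : A' i i * B' i i = 1.
  rewrite -trig_mul_diag // /A' /B' !mulmxA mulmxKV // -(mulmxA P) AB mulmx1 mulmxV //.
  by rewrite mxE eqxx.
have A0 : A' i i != 0 by rewrite -normr_eq0 nA oner_eq0.
apply: (mulfI A0); rewrite ABi -normCK nA expr1n //.
Qed.

Lemma trace_pos (k : numClosedFieldType) n (A : 'M[k]_n) : (0 < n)%N ->
  (forall a, eigenvalue A a -> 0 < a) -> 0 < \tr A.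
Proof.
move=> n0 Apos; have [r er] := closed_field_poly_normal (char_poly A).
move: er; rewrite (monicP (char_poly_monic A)) scale1r => er.
have sr : size r = n.
  by apply: succn_inj; rewrite -(size_prod_XsubC r id) -er size_char_poly.
have -> : \tr A = \sum_(z <- r) z.
  rewrite -[LHS]opprK -(char_poly_trace A n0) er -sr coefPn_prod_XsubC ?opprK //.
  by rewrite sr -lt0n.
have rpos z : z \in r -> 0 < z.
  by move=> zr; apply: Apos; rewrite eigenvalue_root_char er root_prod_XsubC.
case: r sr rpos {er} => [sr|z r _ rpos]; first by rewrite -sr in n0.
rewrite big_cons ltr_wpDr ?rpos ?mem_head //.
by rewrite big_seq sumr_ge0 // => y yr; rewrite ltW // rpos // inE yr orbT.
Qed.

Variables (k : fieldType) (V : vectType k).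

(* Row i lists the coordinates of X b_i, so that products are reversed in [mxv_comp]. *)
Definition mxv (U : {vspace V}) (X : V -> V) : 'M[k]_(\dim U) :=
  \matrix_(i, j) coord (vbasis U) j (X (vbasis U)`_i).

Lemma mxv_trace U X : \tr (mxv U X) = trv U X.
Proof. by apply: eq_bigr => i _; rewrite mxE. Qed.

Lemma eq_mxv (U : {vspace V}) X Y : {in U, X =1 Y} -> mxv U X = mxv U Y.
Proof.
move=> eXY; apply/matrixP => i j; rewrite !mxE eXY //.
by rewrite vbasis_mem // mem_nth ?size_tuple.
Qed.

Lemma mxv_comp (U : {vspace V}) X Y : lin Y -> {in U, forall y, X y \in U} ->
  mxv U (Y \o X) = mxv U X *m mxv U Y.
Proof.
move=> lY XU; apply/matrixP => i j; rewrite !mxE /=.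
have bU : (vbasis U)`_i \in U by rewrite vbasis_mem // mem_nth ?size_tuple.
rewrite {1}(coord_vbasis (XU _ bU)) lin_sum // linear_sum; apply: eq_bigr => s _.
by rewrite linZ // linearZ !mxE.
Qed.

Lemma mxvZ (U : {vspace V}) a X : mxv U (fun y => a *: X y) = a *: mxv U X.
Proof. by apply/matrixP => i j; rewrite !mxE linearZ. Qed.

Lemma mxv_id (U : {vspace V}) : mxv U id = 1%:M.
Proof.
apply/matrixP => i j; rewrite !mxE coord_free ?(basis_free (vbasisP U)) //.
Qed.

End Matrices.

Section HalfSum.
Variables (k : numFieldType) (A : algType k).

(** For an idempotent p commuting with an involution s, this projects onto the part of the image of
    p where s = 1. The trace of p s is thus a difference of two ranks. *)
Definition half_sum (p s : A) : A := 2^-1 *: (p + p * s).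

Lemma half_idem (p s : A) : p * p = p -> s * s = 1 -> p * s = s * p ->
  half_sum p s * half_sum p s = half_sum p s.
Proof.
move=> pp ss ps; rewrite /half_sum -scalerAl -scalerAr scalerA.
have -> : (p + p * s) * (p + p * s) = 2 *: (p + p * s).
  have psp : p * s * p = p * s by rewrite -mulrA -ps mulrA pp.
  rewrite mulrDl !mulrDr mulrA pp psp mulrA psp -mulrA ss mulr1.
  by rewrite scaler_nat mulr2n [p * s + p]addrC.
by rewrite scalerA -mulrA mulVf ?mulr1 // pnatr_eq0.
Qed.

Lemma half_sumB (p s : A) : p * s + half_sum p (- s) = half_sum p s.
Proof.
apply: (@scalerI _ _ 2); first by rewrite pnatr_eq0.
rewrite scalerDr !scalerA mulfV ?pnatr_eq0 // !scale1r scaler_nat mulr2n mulrN.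
by rewrite addrCA addrK addrC.
Qed.

Lemma half_sum1 (s : A) : 2 *: half_sum 1 (- s) = 1 - s.
Proof. by rewrite scalerA mulfV ?pnatr_eq0 // scale1r mul1r. Qed.

End HalfSum.

(** * Regular character, Nakayama automorphism and distinguished group-like element *)

Section Nakayama.
Variables (k : numClosedFieldType) (H : hopfType k).
Local Notation S := (@antipode k H).
Local Notation eps := (@counit k H).
Implicit Types (x y : H) (f u v : 'Hom(H, k^o)).

Definition reg_char : 'Hom(H, k^o) := linfun (fun x => trv fullv (fun y => x * y) : k^o).
Local Notation chi := reg_char.

Lemma reg_charE x : chi x = trv fullv (fun y => x * y).
Proof.
rewrite lin_linfunE // => a u v.
rewrite /GRing.scale /= -trvZ -trvD; apply: eq_trv => y _.
by rewrite mulrDl scalerAl.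
Qed.

Lemma reg_charC x y : chi (x * y) = chi (y * x).
Proof.
rewrite !reg_charE.
transitivity (trv fullv ((fun z => x * z) \o (fun z => y * z))).
  by apply: eq_trv => z _ /=; rewrite mulrA.
rewrite trv_comp; try lin.
by apply: eq_trv => z _ /=; rewrite mulrA.
Qed.

(** The left ideal H y has an idempotent generator e; left multiplication by e has trace 0, hence
    rank 0 in characteristic 0. *)
Lemma reg_char_nondeg y : semisimple H -> (forall x, chi (x * y) = 0) -> y = 0.
Proof.
move=> ssH chiy.
have [|e [eI ee ye]] := left_ideal_idem ssH (_ : left_ideal (limg (amulr y))).
  apply/left_idealP => x _ /memv_imgP[z _ ->].
  by rewrite lfunE /= mulrA; apply/memv_imgP; exists (x * z); rewrite ?memvf // lfunE.
suff e0 : e = 0.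
  by rewrite -(ye y) ?e0 ?mulr0 //; apply/memv_imgP; exists 1; rewrite ?memvf // lfunE /= mul1r.
have: amull e = 0.
  apply: trv_idem_eq0 => [z|]; first by rewrite !lfunE /= mulrA ee.
  transitivity (chi e : k); last by have /memv_imgP[z _ ->] := eI; rewrite lfunE /= chiy.
  by rewrite reg_charE; apply: eq_trv => z _; rewrite lfunE.
by move/lfunP/(_ 1); rewrite !lfunE /= mulr1.
Qed.

Lemma convA f u v : conv (conv f u) v = conv f (conv u v).
Proof. by apply/lfunP => x; rewrite !convE_comul comul_conv. Qed.

Lemma conv1f f : conv eps f = f.
Proof.
by apply/lfunP => x; rewrite conv_sw sw_counl; lin.
Qed.

Definition grouplike (g : H) : Prop := comul g = g ⊗ g /\ eps g = 1 :> k.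

Lemma grouplikeP (g : H) :
  (forall u v, conv u v g = (u g : k) * v g) -> eps g = 1 :> k -> grouplike g.
Proof.
move=> mg eg; split=> //; apply/lfunP => u; rewrite tensE.
apply: functional_eq => v; rewrite -convE_comul mg linearZ /=.
by rewrite /GRing.scale.
Qed.

Lemma sw_grouplike (W : vectType k) (B : H -> H -> W) (g : H) :
  (forall b, lin (fun a => B a b)) -> (forall a, lin (B a)) -> grouplike g ->
  \sw_(a, b <- g) B a b = B g g.
Proof. by move=> B1 B2 [-> _]; rewrite tlift_tens. Qed.

Lemma grouplikeM (g h : H) : grouplike g -> grouplike h -> grouplike (g * h).
Proof.
move=> gg gh; apply: grouplikeP; last by rewrite counitM gg.2 gh.2 mulr1.
move=> u v; rewrite conv_sw swM; try lin.
rewrite (@sw_grouplike _ (fun a b => \sw_(c, d <- h) ((u (a * c) : k) *: v (b * d)))) //; try lin.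
by rewrite (@sw_grouplike _ (fun c d => (u (g * c) : k) *: v (g * d))) //; lin.
Qed.

Lemma grouplike1 : grouplike 1.
Proof. by split; [exact: comul1 | exact: counit1]. Qed.

Lemma grouplike_unit g : grouplike g -> g \is a GRing.unit.
Proof.
move=> gg; apply/unitrP; exists (S g); split.
  have := antipodel g; rewrite (@sw_grouplike _ (fun a b => S a * b)) //; try lin.
  by rewrite gg.2 scale1r.
have := antipoder g; rewrite (@sw_grouplike _ (fun a b => a * S b)) //; try lin.
by rewrite gg.2 scale1r.
Qed.

Lemma grouplike_finite_order g (s : seq H) : (forall h, grouplike h -> h \in s) ->
  grouplike g -> exists2 m, (0 < m)%N & g ^+ m = 1.
Proof.
move=> fin gg.
have gX m : grouplike (g ^+ m).
  by elim: m => [|m IHm]; [exact: grouplike1 | rewrite exprS; apply: grouplikeM].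
have finU m : g ^+ m \in undup s by rewrite mem_undup fin.
pose f (i : 'I_(size (undup s)).+1) : seq_sub (undup s) := SeqSub (finU i).
have /injectivePn[i [j ij fij]] : ~~ injectiveb f.
  apply/negP => /injectiveP /leq_card.
  by rewrite card_ord card_seq_sub ?undup_uniq // ltnn.
have {}fij : g ^+ i = g ^+ j by have := congr1 val fij.
wlog lij : i j ij fij / (i < j)%N.
  move=> W; have [] := ltngtP i j; [exact: W| |by move/val_inj/eqP; rewrite (negPf ij)].
  by apply: W; rewrite // eq_sym.
exists (j - i)%N; first by rewrite subn_gt0.
apply: (mulrI (unitrX i (grouplike_unit gg))).
by rewrite -exprD subnKC ?mulr1 // ltnW.
Qed.

Section Twist.
Hypothesis ssH : semisimple H.
Variable L : H.
Hypotheses (intl : forall y, y * L = (eps y : k) *: L)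
  (intr : forall y, L * y = (eps y : k) *: L) (epsL : eps L = 1 :> k).
Variable lam : 'Hom(H, k^o).
Hypothesis lamL : comul L lam = 1.

Definition twist : H := \sw_(a, b <- L) (S b * a).
Local Notation w := twist.

Lemma chi_lam x : chi x = lam (x * w).
Proof.
rewrite reg_charE (trace_lam intl lamL); last lin.
rewrite /w (@lin_tliftE _ _ _ _ _ (fun z => lam (x * z))); last lin.
by apply: eq_tlift => a b; rewrite mulrA.
Qed.

Lemma twistC x : w * x = S (S x) * w.
Proof.
rewrite /w (@lin_tliftE _ _ _ _ _ (fun z => z * x)); last lin.
rewrite (@lin_tliftE _ _ _ _ _ (fun z => S (S x) * z)); last lin.
transitivity (\sw_(a, b <- L) (S b * (a * x))).
  by apply: eq_tlift => a b; rewrite mulrA.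
rewrite (@integral_right _ _ _ (fun a b => S b * a)) //; try lin.
by apply: eq_tlift => a b; rewrite antipodeM mulrA.
Qed.

Lemma twist_unit : w \is a GRing.unit.
Proof.
have inj y : y * w = 0 -> y = 0.
  move=> yw; apply: (reg_char_nondeg ssH) => x.
  by rewrite chi_lam -mulrA yw mulr0 linear0.
have: 1 \in limg (amulr w).
  suff -> : limg (amulr w) = fullv by rewrite memvf.
  apply/eqP; rewrite eqEdim subvf /= limg_dim_eq // capfv; apply/eqP.
  rewrite -subv0; apply/subvP => y.
  by rewrite memv_ker lfunE /= memv0 => /eqP /inj ->.
case/memv_imgP => v _; rewrite lfunE /= => vw.
apply/unitrP; exists v; split=> //; apply/eqP; rewrite -subr_eq0; apply/eqP/inj.
by rewrite mulrBl mul1r -mulrA -vw mulr1 subrr.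
Qed.

Lemma lam_chi x : lam x = chi (x * w^-1).
Proof. by rewrite chi_lam mulrVK // twist_unit. Qed.

Lemma twistVC x : w^-1 * S (S x) = x * w^-1.
Proof.
apply: (mulrI twist_unit); apply: (mulIr twist_unit).
by rewrite mulVKr ?twist_unit // -(mulrA w) mulrVK ?twist_unit // twistC.
Qed.

(** S^2 is the Nakayama automorphism of lam, since lam is the trace form chi twisted by w^-1 and w
    implements S^2. *)
Lemma nakayama x y : lam (S (S x) * y) = lam (y * x).
Proof. rewrite !lam_chi -[in LHS]mulrA [LHS]reg_charC.
by rewrite -(mulrA y w^-1) twistVC mulrA. Qed.

Lemma lam_nondegr x : (forall y, lam (y * x) = 0) -> x = 0.
Proof.
move=> x0; have wV : w^-1 \is a GRing.unit by rewrite unitrV twist_unit.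
apply: (mulIr wV); rewrite mul0r.
by apply: (reg_char_nondeg ssH) => y; rewrite mulrA -lam_chi.
Qed.

(** Conjugation by S turns left multiplication by S(x) into right multiplication by x, of trace
    lam(S(L_2) x L_1); S(L) = L and the Nakayama automorphism turn this into lam(x w). *)
Lemma reg_char_antipode x : chi (S x) = chi x.
Proof.
have S_inj : lker S == 0%VS.
  rewrite -subv0; apply/subvP => y; rewrite memv_ker memv0 => /eqP Sy.
  by rewrite (antipode_inj intl epsL Sy).
transitivity (trv fullv ((fun y => S (y * x)) \o (fun y => (S^-1)%VF y))).
  rewrite reg_charE; apply: eq_trv => y _ /=.
  by rewrite antipodeM lker0_lfunVK.
rewrite trv_comp; try lin.
transitivity (trv fullv (fun y => y * x)).
  by apply: eq_trv => y _ /=; rewrite lker0_lfunK.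
rewrite (trace_lam intl lamL); last lin.
rewrite -(@sw_antipode_int _ _ L intl intr epsL _ (fun a b => lam (S b * x * a))); try lin.
rewrite chi_lam /w (@lin_tliftE _ _ _ _ _ (fun z => lam (x * z))); last lin.
by apply: eq_tlift => a b; rewrite -mulrA nakayama mulrA.
Qed.

(** The distinguished group-like element: by [conv_lamr], H^* acts on its integral lam from the left
    through u |-> u(g). *)
Definition modular : H := \sw_(a, b <- L) ((lam b : k) *: a).
Local Notation g := modular.

(** The dual bases give S(x) as the sum of lam(S(x) L_1) S(L_2); remove S, which is injective, and
    apply lam. *)
Lemma lam_modular x : lam (S x * g) = lam x.
Proof.
rewrite /g (@lin_tliftE _ _ _ _ _ (fun z => lam (S x * z))); last lin.
transitivity (lam (\sw_(a, b <- L) ((lam (S x * a) : k) *: b))).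
  rewrite [RHS](@lin_tliftE _ _ _ _ _ lam); last lin.
  by apply: eq_tlift => a b; rewrite -scalerAr !linearZ /= /GRing.scale /= mulrC.
congr (lam _); apply/eqP; rewrite -subr_eq0; apply/eqP/(antipode_inj intl epsL).
rewrite linearB /=; apply/eqP; rewrite subr_eq0; apply/eqP.
rewrite (@lin_tliftE _ _ _ _ _ S); last lin.
apply: (etrans _ (lam_dual_basis intl lamL (S x) (@lin_id _ H))).
by apply: eq_tlift => a b; rewrite linearZ.
Qed.

(** Tested against lam(S(x) _): turn lam into chi by w^-1, use that chi is cyclic and invariant
    under S, and turn back. *)
Lemma modularE : g = S w^-1 * w.
Proof.
apply/eqP; rewrite -subr_eq0; apply/eqP/lam_nondegr => y.
have [x ->] := antipode_surj intl epsL y.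
rewrite mulrBr linearB /= lam_modular mulrA [X in _ - X]lam_chi.
rewrite mulrK ?twist_unit // -[X in _ - X]reg_charC -antipodeM reg_char_antipode.
by rewrite -lam_chi subrr.
Qed.

Lemma conv_modular u : conv u lam L = u g.
Proof.
rewrite conv_sw /g (@lin_tliftE _ _ _ _ _ u); last lin.
by apply: eq_tlift => a b; rewrite linearZ /= /GRing.scale /= mulrC.
Qed.

(** The left side has the integral property of lam, so uniqueness makes it a multiple of lam, the
    factor being its value at L. *)
Lemma conv_lamr u : conv u lam = (u g : k) *: lam.
Proof.
rewrite -conv_modular; apply: (lam_unique intl epsL lamL) => v.
rewrite convA (conv_lam intl epsL lamL); apply/lfunP => x.
by rewrite convE_comul !scale_lfunE convE_comul.
Qed.

Lemma modular_grouplike : grouplike g.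
Proof.
apply: grouplikeP => [u v|]; last by rewrite -conv_modular conv1f (lam_int lamL).
rewrite -(conv_modular (conv u v)) convA conv_lamr convE_comul scale_lfunE.
by rewrite -convE_comul conv_modular /GRing.scale /= mulrC.
Qed.

Definition twist2 : H := w * S w.
Local Notation c := twist2.

Lemma antipode_twistC y : S w * S (S y) = y * S w.
Proof.
by have [x ->] := antipode_surj intl epsL y; rewrite -!antipodeM -twistC.
Qed.

Lemma twist2C x : c * x = x * c.
Proof.
have [y ->] := antipode_surj intl epsL x; have [z ->] := antipode_surj intl epsL y.
by rewrite /c -mulrA antipode_twistC mulrA twistC mulrA.
Qed.

Lemma antipode_twistV : S w * S w^-1 = 1.
Proof. by rewrite -antipodeM mulVr ?twist_unit // antipode1. Qed.

Lemma twist2_unit : c \is a GRing.unit.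
Proof.
apply/unitrP; exists (S w^-1 * w^-1); split.
  by rewrite mulrA mulrVK ?twist_unit // -antipodeM mulrV ?twist_unit // antipode1.
by rewrite /c mulrA -(mulrA w) antipode_twistV mulr1 mulrV ?twist_unit.
Qed.

Lemma twist_sqr : w * w = c * g.
Proof.
by rewrite modularE /c mulrA -(mulrA w) antipode_twistV mulr1.
Qed.

(** Under a trace form S(L_2) L_1 may be replaced by L_1 S(L_2), whose sum is eps(L) = 1. *)
Lemma trace_twist (tau : 'Hom(H, k^o)) : (forall x y, tau (x * y) = tau (y * x)) ->
  tau w = tau 1 /\ tau (S w) = tau 1.
Proof.
move=> tauC; split.
  rewrite /w (@lin_tliftE _ _ _ _ _ tau); last lin.
  transitivity (\sw_(a, b <- L) tau (a * S b)).
    by apply: eq_tlift => a b; rewrite tauC.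
  by rewrite (@sw_antir _ _ _ tau) ?epsL ?scale1r; lin.
rewrite /w (@lin_tliftE _ _ _ _ _ (fun z => tau (S z))); last lin.
transitivity (\sw_(a, b <- L) tau (S (a * S b))).
  by apply: eq_tlift => a b; rewrite !antipodeM tauC.
by rewrite (@sw_antir _ _ _ (fun z => tau (S z))) ?epsL ?scale1r ?antipode1; lin.
Qed.

Lemma twist2VC x : c^-1 * x = x * c^-1.
Proof.
apply: (mulrI twist2_unit); apply: (mulIr twist2_unit).
by rewrite mulVKr ?twist2_unit // -mulrA mulrVK ?twist2_unit // twist2C.
Qed.

Lemma twistV : w^-1 = c^-1 * S w.
Proof.
apply: (mulrI twist_unit); rewrite mulrV ?twist_unit // mulrA -twist2VC -mulrA.
by rewrite mulVr // twist2_unit.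
Qed.

(** w^-1 = c^-1 S(w), and x |-> chi(c^-1 x) is a trace form because c is central, so [trace_twist]
    replaces S(w) by 1. *)
Lemma lam1E : lam 1 = chi c^-1.
Proof.
rewrite lam_chi mul1r twistV.
pose tau : 'Hom(H, k^o) := linfun (fun x => chi (c^-1 * x)).
have tauE x : tau x = chi (c^-1 * x) by rewrite lin_linfunE //; lin.
have tauC x y : tau (x * y) = tau (y * x).
  by rewrite !tauE mulrA [LHS]reg_charC (twist2VC x) mulrA [LHS]reg_charC.
by rewrite -tauE (trace_twist tauC).2 tauE mulr1.
Qed.

Lemma eigen_vector (V : vectType k) (X : V -> V) a : lin X ->
  eigenvalue (mxv fullv X) a -> exists2 y, y != 0 & X y = a *: y.
Proof.
move=> lX /eigenvalueP[v va v0].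
pose y := \sum_i v 0 i *: (vbasis {:V})`_i.
have fr : free (vbasis {:V}) := basis_free (vbasisP _).
have cy i : coord (vbasis {:V}) i y = v 0 i by rewrite coord_sum_free.
exists y.
  apply: contraNneq v0 => y0; apply/eqP/rowP => i.
  by rewrite -cy y0 linear0 mxE.
rewrite [LHS](coord_vbasis (memvf (X y))) [RHS](coord_vbasis (memvf (a *: y))).
apply: eq_bigr => j _; congr (_ *: _); rewrite linearZ /= cy /=.
move/rowP/(_ j): va; rewrite !mxE => <-.
rewrite lin_sum // linear_sum; apply: eq_bigr => i _.
by rewrite linZ // linearZ !mxE.
Qed.

(* On the eigenspace E of c^-1 for a, with v^2 = a, the matrix of v w has finite
   order, hence the trace of its inverse is the conjugate of its trace.  Both
   traces are v * dim E, so v is real. *)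
Lemma twist2V_eigen_pos a y : y != 0 -> c^-1 * y = a *: y ->
  (exists2 m, (0 < m)%N & g ^+ m = 1) -> 0 < a.
Proof.
move=> y0 ya [m m0 gm].
pose E := lker (amull c^-1 - a *: \1%VF).
have memE z : (z \in E) = (c^-1 * z == a *: z).
  by rewrite memv_ker add_lfunE opp_lfunE scale_lfunE !lfunE /= subr_eq0.
have stE x z : z \in E -> x * z \in E.
  by rewrite !memE => /eqP Ez; rewrite mulrA twist2VC -mulrA Ez scalerAr.
have d0 : (\dim E)%:R != 0 :> k.
  rewrite pnatr_eq0 dimv_eq0; apply: contraNneq y0 => E0.
  by rewrite -memv0 -E0 memE ya.
pose M x := mxv E (fun z => x * z).
have MM x z : M (x * z) = M z *m M x.
  rewrite -mxv_comp; [|lin|by move=> u; apply: stE].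
  by apply: eq_mxv => u _ /=; rewrite mulrA.
have M1 : M 1 = 1%:M by rewrite -mxv_id; apply: eq_mxv => u _; rewrite mul1r.
have Mc : M c^-1 = a%:M.
  rewrite -[a]mulr1 -scale_scalar_mx -mxv_id -mxvZ; apply: eq_mxv => u.
  by rewrite memE => /eqP.
have trM x : \tr (M x) = trv E (fun z => x * z) by rewrite mxv_trace.
pose tau : 'Hom(H, k^o) := linfun (fun x => \tr (M x) : k^o).
have tauE x : tau x = \tr (M x).
  rewrite lin_linfunE // => b u v; rewrite !trM /GRing.scale /= -trvZ -trvD.
  by apply: eq_trv => z _; rewrite mulrDl scalerAl.
have tauC x z : tau (x * z) = tau (z * x) by rewrite !tauE !MM mxtrace_mulC.
have [] := trace_twist tauC; rewrite !tauE M1 mxtrace1 => trw trSw.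
have trwV : \tr (M w^-1) = a * (\dim E)%:R.
  by rewrite twistV MM Mc mul_mx_scalar mxtraceZ trSw.
have a0 : a != 0.
  apply: contraNneq d0 => a0; have := congr1 (fun A => \tr A) M1.
  rewrite -(mulrV twist2_unit) MM Mc a0 mul_scalar_mx scale0r mxtrace0 mxtrace1.
  by move=> <-.
pose v := sqrtC a; have vv : v * v = a by rewrite -expr2 sqrtCK.
have v0 : v != 0 by rewrite sqrtC_eq0.
have VV : (v *: M w) *m (v^-1 *: M w^-1) = 1%:M.
  by rewrite -scalemxAl -scalemxAr scalerA mulfV // scale1r -MM mulVr ?twist_unit.
(* On E the square of v w is c^-1 w^2 = g, hence the exponent 2 m. *)
have V2m : (v *: M w) ^+ (2 * m) = 1%:M.
  have -> : (v *: M w) ^+ (2 * m) = M (g ^+ m).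
    rewrite exprM; have -> : (v *: M w) ^+ 2 = M g.
      rewrite expr2 -mulmxE -scalemxAl -scalemxAr scalerA vv -MM.
      rewrite -mul_scalar_mx -Mc -MM twist_sqr -mulrA -twist2VC.
      by rewrite mulVKr ?twist2_unit.
    elim: m {m0 gm} => [|m IHm]; first by rewrite !expr0 M1.
    by rewrite exprSr exprS IHm MM.
  by rewrite gm M1.
have := finite_order_trace _ VV V2m; rewrite muln_gt0 m0 => /(_ isT).
rewrite !mxtraceZ trw trwV -{1}vv !mulrA mulVf // mul1r rmorphM /= conjC_nat.
move/(mulIf d0)/esym/CrealP => vr.
by rewrite -vv -expr2 real_exprn_even_gt0.
Qed.

Lemma lam1_pos : (exists2 m, (0 < m)%N & g ^+ m = 1) -> (0 : k) < lam 1.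
Proof.
move=> gfin; rewrite lam1E reg_charE -mxv_trace; apply: trace_pos.
  by rewrite dimvf FalgType_proper.
move=> a /eigen_vector[|y y0 ya]; first by lin.
exact: (twist2V_eigen_pos y0 ya gfin).
Qed.

Lemma antipodeK_lker : lker S == 0%VS.
Proof.
rewrite -subv0; apply/subvP => y; rewrite memv_ker memv0 => /eqP Sy.
by rewrite (antipode_inj intl epsL Sy).
Qed.

(** The integral property of lam at S(x), tested on u composed with the inverse of S; S exchanges
    the two legs of the coproduct. *)
Lemma conv_lamS u : conv u (lam \o S)%VF = (u 1 : k) *: (lam \o S)%VF.
Proof.
apply/lfunP => x; pose v y := u ((S^-1)%VF y).
have SK y : (S^-1)%VF (S y) = y by rewrite lker0_lfunK // antipodeK_lker.
have lv : lin v by rewrite /v; lin.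
have v1 : v 1 = u 1 by rewrite /v -{1}antipode1 SK.
have := sw_lam intl epsL lamL (S x) lv.
rewrite (@sw_antipode _ _ _ (fun a b => (lam a : k) *: v b)) //; try lin.
rewrite v1 scale_lfunE comp_lfunE /GRing.scale /= mulrC => <-.
rewrite conv_sw; apply: eq_tlift => a b.
by rewrite comp_lfunE /v SK /GRing.scale /= mulrC.
Qed.

Section Unimodular.
Hypothesis lam1 : lam 1 != 0 :> k.

(** The convolution of lam with lam o S is evaluated twice, by the integral property of each factor;
    then lam(1) cancels. *)
Lemma lam_antipode x : lam (S x) = lam x.
Proof.
have := conv_lam intl epsL lamL (lam \o S)%VF.
rewrite conv_lamS comp_lfunE antipode1 => /(scalerI lam1)/lfunP/(_ x).
by rewrite comp_lfunE.
Qed.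

Lemma modular1 : g = 1.
Proof.
apply/eqP; rewrite -subr_eq0; apply/eqP/lam_nondegr => y.
have [x ->] := antipode_surj intl epsL y.
by rewrite mulrBr linearB /= lam_modular mulr1 lam_antipode subrr.
Qed.

Lemma antipode_twist : S w = w.
Proof. by rewrite -[RHS]mul1r -antipode_twistV -mulrA -modularE modular1 mulr1. Qed.

Lemma antipode4 x : S (S (S (S x))) = x.
Proof.
apply: (mulIr twist2_unit); rewrite -[in RHS]twist2C /c antipode_twist mulrA -twistC.
by rewrite -!mulrA -twistC.
Qed.

End Unimodular.

(** In lam(x y_1) S(y_2) the integral property expands lam(x y_1) as lam(x_1 y_1) x_2 y_2; then y_2
    S(y_3) cancels. *)
Lemma sw_lamM (W : vectType k) (F : H -> W) x y : lin F ->
  \sw_(a, b <- x) ((lam (a * y) : k) *: F b) =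
  \sw_(a, b <- y) ((lam (x * a) : k) *: F (S b)).
Proof.
move=> lF; apply/esym.
transitivity (\sw_(a, b <- y) (\sw_(p, q <- x) (\sw_(c, d <- a)
    ((lam (p * c) : k) *: F (q * d * S b))))).
  apply: eq_tlift => a b; rewrite -[S b]mul1r.
  rewrite -(sw_lam intl epsL lamL (F := fun z => F (z * S b))); last lin.
  by rewrite (@swM _ _ _ (fun p q => (lam p : k) *: F (q * S b))) ?mul1r; lin.
rewrite sw_exchange; apply: eq_tlift => p q.
rewrite (@swA _ _ _ (fun c d b => (lam (p * c) : k) *: F (q * d * S b))); try lin.
transitivity (\sw_(a, b <- y) (\sw_(c, d <- b) ((lam (p * a) : k) *: F (q * (c * S d))))).
  by apply: eq_tlift => a b; apply: eq_tlift => c d; rewrite mulrA.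
by rewrite (@sw_antirr _ _ _ (fun a z => (lam (p * a) : k) *: F (q * z))) ?mulr1; lin.
Qed.

(** By [sw_lamM] the left side at x is the sum of lam(x w_1) tau(S(w_2)). The coproduct of w is
    S(L_4) L_1 ⊗ S(L_3) L_2, and since tau is a trace form L_2 S(L_3) cancels. *)
Lemma conv_chi (tau : 'Hom(H, k^o)) : (forall x y, tau (x * y) = tau (y * x)) ->
  conv chi tau = (tau 1 : k) *: chi.
Proof.
move=> tauC; apply/lfunP => x; rewrite conv_sw scale_lfunE.
transitivity (\sw_(a, b <- x) ((lam (a * w) : k) *: tau b)).
  by apply: eq_tlift => a b; rewrite chi_lam.
rewrite sw_lamM; last lin.
pose G p q := (lam (x * p) : k) *: tau (S q).
rewrite -/(G _ _) {1}/w (@lin_tliftE _ _ _ _ _ (fun z => \sw_(p, q <- z) G p q)); last first.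
  by rewrite /G; lin.
transitivity (\sw_(a, b <- L) (\sw_(p, q <- a) (\sw_(r, s <- b)
   ((lam (x * (S s * p)) : k) *: tau (S (q * S r)))))).
  apply: eq_tlift => a b; rewrite /G.
  rewrite (@swM _ _ _ (fun p q => (lam (x * p) : k) *: tau (S q))); try lin.
  rewrite (@sw_antipode _ _ _ (fun r s => \sw_(p, q <- a)
    ((lam (x * (r * p)) : k) *: tau (S (s * q))))); try lin.
  rewrite sw_exchange; apply: eq_tlift => p q; apply: eq_tlift => r s.
  by rewrite !antipodeM tauC.
rewrite (@swA _ _ _ (fun p q b => \sw_(r, s <- b)
   ((lam (x * (S s * p)) : k) *: tau (S (q * S r))))); try lin.
transitivity (\sw_(p, q <- L) ((lam (x * (S q * p)) : k) *: tau 1)).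
  apply: eq_tlift => p q; rewrite -[in RHS]antipode1.
  by rewrite (@sw_antirl _ _ _ (fun z s => (lam (x * (S s * p)) : k) *: tau (S z))); lin.
rewrite chi_lam /w (@lin_tliftE _ _ _ _ _ (fun z => (tau 1 : k) *: lam (x * z))); last lin.
by apply: eq_tlift => a b; rewrite /GRing.scale /= mulrC.
Qed.

(** The trace formula gives lam(S^3(L_2) L_1), which the Nakayama automorphism turns into lam(L_1
    S(L_2)). *)
Lemma trace_antipode2 : trv fullv (fun x => S (S x)) = lam 1 :> k^o.
Proof.
rewrite (trace_lam intl lamL); last lin.
transitivity (\sw_(a, b <- L) (lam (a * S b))).
  by apply: eq_tlift => a b; rewrite nakayama.
by rewrite (@sw_antir _ _ _ lam) ?epsL ?scale1r; lin.
Qed.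

Lemma comul_antipode2 x f : (forall y, f (S y) = f y) ->
  comul (S (S x)) f = S (S (comul x f)).
Proof.
move=> fS; rewrite !comulE.
rewrite !(@sw_antipode _ _ _ (fun a b => (f a : k) *: b)); try lin.
rewrite !(@sw_antipode _ _ _ (fun b a => (f (S a) : k) *: S b)); try lin.
rewrite (@lin_tliftE _ _ _ _ _ (fun z => S (S z))); last lin.
by apply: eq_tlift => a b; rewrite !linearZ /= !fS.
Qed.

(** The same computation leaves lam(L_1 S(L_2)) chi(L_3) = lam(1) chi(L), and chi(L) = lam(L w) =
    eps(w) = 1. *)
Lemma trace_chi_antipode2 : trv fullv (fun x => comul (S (S x)) chi) = lam 1 :> k^o.
Proof.
rewrite (trace_lam intl lamL); last first.
  by move=> a u v; rewrite !linearP add_lfunE scale_lfunE.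
transitivity (\sw_(a, b <- L) (\sw_(p, q <- b) ((chi q : k) *: lam (a * S p)))).
  apply: eq_tlift => a b.
  rewrite comul_antipode2; last exact: reg_char_antipode.
  rewrite comulE (@sw_antipode _ _ _ (fun a b => (chi a : k) *: b)); try lin.
  rewrite (@lin_tliftE _ _ _ _ _ (fun z => lam (S (S z) * a))); last lin.
  apply: eq_tlift => p q; rewrite !linearZ /= -scalerAl linearZ /=.
  by rewrite nakayama reg_char_antipode.
rewrite (@sw_antirl _ _ _ (fun z q => (chi q : k) *: lam z)); try lin.
rewrite chi_lam intr linearZ /= (lam_int lamL).
have epsC x y : eps (x * y) = eps (y * x) by rewrite !counitM mulrC.
have [-> _] := trace_twist epsC.
by rewrite counit1 /GRing.scale /= !mul1r.
Qed.

Import FalgLfun.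

(* [P] is convolution by chi / N, an idempotent commuting with the involution s = S^2,
   so Tr (P s) = Tr (s) / N is an integer. *)
Lemma antipodeK_of_pos : (0 : k) < lam 1 -> forall x, S (S x) = x.
Proof.
move=> lam1; have lam10 : lam 1 != 0 :> k by rewrite gt_eqF.
pose N : k := (\dim {:H})%:R.
have N0 : 0 < N by rewrite ltr0n dimvf FalgType_proper.
have chi1 : chi 1 = N.
  by rewrite reg_charE /N -trv_id; apply: eq_trv => y _; rewrite mul1r.
pose Q x := comul x chi.
have lQ : lin Q by move=> a u v; rewrite /Q linearP add_lfunE scale_lfunE.
have QQ x : Q (Q x) = N *: Q x.
  by rewrite /Q -comul_conv conv_chi ?chi1 ?linearZ //; apply: reg_charC.
have QS x : Q (S (S x)) = S (S (Q x)) by rewrite /Q comul_antipode2 //; apply: reg_char_antipode.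
pose P x := N^-1 *: Q x.
have lP : lin P by rewrite /P; lin.
have PP x : P (P x) = P x.
  by rewrite /P (linZ lQ) QQ !scalerA -mulrA mulVf ?mulr1 ?gt_eqF.
have PS x : P (S (S x)) = S (S (P x)) by rewrite /P QS !linearZ.
pose p : 'End(H) := linfun P; pose s : 'End(H) := (S * S).
have pE x : p x = P x by rewrite lin_linfunE.
have sE x : s x = S (S x) by rewrite lfun_mulE.
clearbody s.
have pp : p * p = p by apply/lfunP => x; rewrite lfun_mulE !pE PP.
have ss : s * s = 1 by apply/lfunP => x; rewrite lfun_mulE !sE antipode4 // id_lfunE.
have ps : p * s = s * p.
  by apply/lfunP => x; rewrite lfun_mulE [RHS]lfun_mulE pE pE !sE PS.
have tr_idem (e : 'End(H)) : e * e = e -> trv fullv e = (\dim (limg e))%:R.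
  by move=> ee; apply: trv_idem => y; rewrite -lfun_mulE ee.
have ns : (- s) * (- s) = 1 by rewrite mulrNN.
have e1 := half_idem pp ss ps.
have e2 : _ = half_sum p (- s) := half_idem pp ns (etrans (mulrN _ _) (etrans (congr1 -%R ps) (esym (mulNr _ _)))).
have e3 : _ = half_sum 1 (- s) := half_idem (mulr1 1) ns (etrans (mul1r _) (esym (mulr1 _))).
have trs : trv fullv s = lam 1 :> k.
  by rewrite -trace_antipode2; apply: eq_trv => y _; rewrite sE.
have trps : trv fullv (p * s) = N^-1 * lam 1.
  rewrite -trace_chi_antipode2 -trvZ; apply: eq_trv => y _.
  by rewrite lfun_mulE pE sE -PS.
have t12 : trv fullv (half_sum p s) - trv fullv (half_sum p (- s)) = N^-1 * lam 1.
  rewrite -trps; apply/eqP; rewrite subr_eq -trvD; apply/eqP/eq_trv => y _.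
  by rewrite -add_lfunE half_sumB.
have t3 : 2 * trv fullv (half_sum 1 (- s)) = N - lam 1.
  rewrite -trs -trvZ /N -trv_id; apply/eqP; rewrite eq_sym subr_eq -trvD; apply/eqP/eq_trv => y _.
  by rewrite -scale_lfunE half_sum1 add_lfunE opp_lfunE id_lfunE subrK.
move: t12 t3; rewrite !tr_idem //.
set r1 := \dim _; set r2 := \dim _; set r3 := \dim _ => t12 t3.
(* r1 - r2 = lam(1) / N is a positive integer, so N <= lam(1); the dimension r3 of the eigenspace of
   S^2 for -1 satisfies 2 r3 = N - lam(1), so it is 0. *)
have r12 : (r2 < r1)%N by rewrite -(ltr_nat k) -subr_gt0 t12 mulr_gt0 ?invr_gt0.
have Nlam : N <= lam 1.
  have -> : lam 1 = N * (r1%:R - r2%:R) :> k by rewrite t12 mulrA mulfV ?mul1r ?gt_eqF.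
  by rewrite -natrB ?(ltnW r12) // ler_pMr // ler1n subn_gt0.
have r30 : r3 = 0%N.
  apply/eqP; rewrite -leqn0 -(ler_nat k) -(ler_pM2l (ltr0n k 2)) mulr0 t3 subr_le0.
  exact: Nlam.
move=> x; rewrite -sE; suff -> : s = 1 by rewrite id_lfunE.
apply/eqP; rewrite eq_sym -subr_eq0 -half_sum1; apply/eqP.
suff -> : half_sum 1 (- s) = 0 by rewrite scaler0.
apply/lfunP => y; rewrite (_ : (0 : 'End(H)) y = 0); last by rewrite lfunE.
apply/eqP; have /eqP : \dim (limg (half_sum 1 (- s))) = 0%N := r30.
by rewrite dimv_eq0 => /eqP l0; rewrite -memv0 -l0 memv_img ?memvf.
Qed.

Lemma twist1 : (forall x, S (S x) = x) -> w = 1.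
Proof.
move=> SS; rewrite /w; transitivity (\sw_(a, b <- L) (S (S a * b))).
  by apply: eq_tlift => a b; rewrite antipodeM SS.
by rewrite (@sw_antil _ _ _ S) ?epsL ?scale1r ?antipode1 //; lin.
Qed.

End Twist.
End Nakayama.

(** * Involutivity of the antipode, and integrals of Hopf subalgebras *)

Section LarsonRadford.
Variables (k : numClosedFieldType) (H : hopfType k).
Local Notation S := (@antipode k H).
Local Notation eps := (@counit k H).
Local Notation chi := (@reg_char k H).

Theorem larson_radford (s : seq H) : semisimple H ->
  (forall g : H, grouplike g -> g \in s) ->
  [/\ forall x : H, S (S x) = x,
      forall u, conv chi u = (u 1 : k) *: chi
    & forall x, chi (S x) = chi x].
Proof.
move=> ssH fin; have [L [intl intr epsL]] := semisimple_integral ssH.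
have [lam lamL] := dual_integral_exists intl epsL.
have gfin := grouplike_finite_order fin (modular_grouplike intl epsL lamL).
have lam1 := lam1_pos ssH intl intr epsL lamL gfin.
have SS := antipodeK_of_pos ssH intl intr epsL lamL lam1.
have chiE : chi = lam.
  by apply/lfunP => x; rewrite (chi_lam intl lamL) (twist1 epsL SS) mulr1.
split=> //; first by rewrite chiE; apply: (conv_lam intl epsL lamL).
exact: (reg_char_antipode ssH intl intr epsL lamL).
Qed.

Lemma reg_char1 : chi 1 = (\dim {:H})%:R.
Proof. by rewrite reg_charE -trv_id; apply: eq_trv => y _; rewrite mul1r. Qed.

Lemma reg_char1_gt0 : (0 : k) < chi 1.
Proof. by rewrite reg_char1 ltr0n dimvf FalgType_proper. Qed.

Hypothesis SS : forall x : H, S (S x) = x.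
Hypothesis chi_int : forall u, conv chi u = (u 1 : k) *: chi.
Hypothesis chiS : forall x, chi (S x) = chi x.

Lemma sw_chi (W : vectType k) (F : H -> W) x : lin F ->
  \sw_(a, b <- x) ((chi a : k) *: F b) = (chi x : k) *: F 1.
Proof.
move=> lF; apply: functional_eq => u.
pose v := linfun (fun z => u (F z)).
have vE z : v z = u (F z) by rewrite lin_linfunE //; lin.
rewrite linearZ /= -vE.
transitivity (conv chi v x); last by rewrite chi_int scale_lfunE /GRing.scale /= mulrC.
rewrite conv_sw (@lin_tliftE _ _ _ _ _ u); last lin.
by apply: eq_tlift => a b; rewrite linearZ vE.
Qed.

Section Subalgebra.
Variables (K : {aspace H}) (LK : H).
Hypotheses (hK : hopf_subalgebra K) (intK : hopf_integral K LK)
  (epsK : counit LK = (\dim K)%:R :> k).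

Lemma hopf_comul y f : y \in K -> comul y f \in K.
Proof. by case: hK => _ cK _ /cK; apply: tensv_comul. Qed.

Lemma hopf_dim_neq0 : (\dim K)%:R != 0 :> k.
Proof. by rewrite pnatr_eq0 -lt0n adim_gt0. Qed.

(** [LK * S LK] is a nonzero multiple of [LK] and, as S^2 = 1, is fixed by S. *)
Lemma antipode_integral : S LK = LK.
Proof.
have [_ _ SK] := hK; have [LKK iK] := intK.
apply: (scalerI hopf_dim_neq0); rewrite -epsK.
have [_ e2] := iK _ (SK _ LKK); rewrite -[RHS]/((eps LK : k) *: LK) -counit_antipode -e2.
by rewrite -[X in _ = X * _]SS -antipodeM (iK _ (SK _ LKK)).2 linearZ /= counit_antipode.
Qed.

(** Divided by dim K, [LK] is a nonzero idempotent, and the trace of multiplication by it is a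
    rank. *)
Lemma chi_integral_neq0 : chi LK != 0 :> k.
Proof.
have [LKK iK] := intK; have d0 := hopf_dim_neq0.
pose p := ((\dim K)%:R^-1 : k) *: LK.
have pp : p * p = p.
  by rewrite /p -scalerAl -scalerAr (iK _ LKK).1 epsK !scalerA mulfVK.
apply/eqP => chi0; have: amull p = 0.
  apply: trv_idem_eq0 => [z|]; first by rewrite !lfunE /= mulrA pp.
  transitivity (chi p : k); last by rewrite linearZ /= chi0 /GRing.scale /= mulr0.
  by rewrite reg_charE; apply: eq_trv => z _; rewrite lfunE.
move/lfunP/(_ 1); rewrite !lfunE /= mulr1 => p0.
have := congr1 eps p0; rewrite linearZ /= epsK linear0 /GRing.scale /= mulVf //.
by move/eqP; rewrite oner_eq0.
Qed.

(* The trace on K of y |-> sum f(y_1) y_2: Lambda_K is the regular character of K^*. *)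
Lemma trace_coideal f : trv K (fun y => comul y f) = f LK.
Proof.
have [K1 cK SK] := hK; have [LKK iK] := intK.
have lf : lin (fun y => comul y f) by move=> a u v; rewrite linearP add_lfunE scale_lfunE.
(* With a ⊗ b for the coproduct of [LK], the functionals y |-> chi(y a) / chi(LK) and the elements
   S(b) are dual systems on K. *)
have trE g : trv K (fun y => comul y g) = (chi LK)^-1 * (g LK * chi 1) :> k^o.
  have lg : lin (fun y => comul y g) by move=> a u v; rewrite linearP add_lfunE scale_lfunE.
  rewrite (@trv_rank1 _ _ _ _ 'I_(\dim {:H})
    (fun i y => ((chi LK)^-1 : k) *: chi (y * (vbasis {:H})`_i))
    (fun i => comul (S (comul LK (dual_basis i))) g)).
  - transitivity (\sw_(a, b <- LK) (((chi LK)^-1 : k) *: chi (comul (S b) g * a))) => //.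
    rewrite -(@lin_tliftE _ _ _ _ _ (fun z : k^o => ((chi LK)^-1 : k) *: z)); last lin.
    congr (_ *: _).
    transitivity (\sw_(a, b <- LK) (\sw_(p, q <- b) ((g (S q) : k) *: chi (a * S p)))).
      apply: eq_tlift => a b; rewrite comulE.
      rewrite (@sw_antipode _ _ _ (fun a b => (g a : k) *: b)); try lin.
      rewrite (@lin_tliftE _ _ _ _ _ (fun z => chi (z * a))); last lin.
      by apply: eq_tlift => p q; rewrite -scalerAl linearZ /= reg_charC.
    rewrite (@sw_antirl _ _ _ (fun z q => (g (S q) : k) *: chi z)); try lin.
    by rewrite antipode_integral.
  - by move=> i; lin.
  - move=> i; apply/hopf_comul/SK/hopf_comul/LKK.
  move=> y yK.
  have ey : \sw_(a, b <- LK) ((chi (y * a) : k) *: S b) = (chi LK : k) *: y.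
    rewrite (@casimir _ _ _ (fun a b => (chi a : k) *: b) _ _ K) //; try lin; last first.
      by move=> z zK; have [] := iK z zK.
    transitivity (S (\sw_(a, b <- LK) ((chi a : k) *: b)) * y).
      rewrite (@lin_tliftE _ _ _ _ _ (fun z => S z * y)); last lin.
      by apply: eq_tlift => a b; rewrite linearZ scalerAl.
    by rewrite (@sw_chi _ id) // linearZ /= antipode1 -scalerAl mul1r.
  rewrite -{1}[y](scalerK chi_integral_neq0) -ey (linZ lg).
  rewrite (@lin_tliftE _ _ _ _ _ (fun z => comul z g)) // /tlift scaler_sumr.
  by apply: eq_bigr => i _; rewrite (linZ lg) scalerA.
(* For g = eps the operator is the identity and eps(LK) = dim K, which shows that chi(1) =
   chi(LK). *)
have := trE eps; rewrite (eq_trv (Y := id)); last by move=> y _; rewrite comulE counitl.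
rewrite trv_id epsK mulrCA => /eqP; rewrite -{1}[_%:R]mulr1 => /eqP/(mulfI hopf_dim_neq0) e1.
by rewrite trE mulrCA -e1 mulr1.
Qed.

End Subalgebra.
End LarsonRadford.

(** * Representations of the dual algebra *)

Section Comatrix.
Variables (k : fieldType) (H : hopfType k).
Local Notation S := (@antipode k H).
Local Notation eps := (@counit k H).
Implicit Types (f g u : 'Hom(H, k^o)).

(** The coefficient matrix of an H-comodule. The index type is any finite type, so that tensor
    products can be indexed by pairs. *)
Definition comatrix (I : finType) (z : I -> I -> H) : Prop :=
  (forall i j, comul (z i j) = \sum_s z i s ⊗ z s j) /\
  (forall i j, eps (z i j) = (i == j)%:R :> k).

Definition ch (I : finType) (z : I -> I -> H) : H := \sum_i z i i.

(* The representation f |-> (f(z_ij)) of H^* with matrix coefficients z. *)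
Definition evm n (z : 'I_n -> 'I_n -> H) f : 'M[k]_n := \matrix_(i, j) (f (z i j) : k).

Lemma sw_comatrix (W : vectType k) (B : H -> H -> W) (I : finType) (z : I -> I -> H) i j :
  (forall b, lin (fun a => B a b)) -> (forall a, lin (B a)) -> comatrix z ->
  \sw_(a, b <- z i j) B a b = \sum_s B (z i s) (z s j).
Proof.
move=> B1 B2 [cz _]; have lB : lin (tlift B) by apply: tlift_linear.
by rewrite cz lin_sum //; apply: eq_bigr => s _; rewrite tlift_tens.
Qed.

Lemma comatrix_conv (I : finType) (z : I -> I -> H) f g i j : comatrix z ->
  conv f g (z i j) = \sum_s (f (z i s) : k) * g (z s j).
Proof. by move=> cz; rewrite conv_sw sw_comatrix //; lin. Qed.

Lemma comatrix_of_conv (I : finType) (z : I -> I -> H) :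
  (forall f g i j, conv f g (z i j) = \sum_s (f (z i s) : k) * g (z s j)) ->
  (forall i j, eps (z i j) = (i == j)%:R :> k) -> comatrix z.
Proof.
move=> cz ez; split=> // i j; apply/lfunP => f; apply: functional_eq => g.
rewrite -convE_comul cz sum_lfunE linear_sum; apply: eq_bigr => s _.
by rewrite tensE linearZ.
Qed.

Lemma comatrix_antir (I : finType) (z : I -> I -> H) i j : comatrix z ->
  \sum_s z i s * S (z s j) = (i == j)%:R.
Proof.
move=> cz; rewrite -(@sw_comatrix _ (fun a b => a * S b)) //; try lin.
by rewrite (@sw_antir _ _ _ id) // cz.2 scaler_nat.
Qed.

Lemma comatrix_antil (I : finType) (z : I -> I -> H) i j : comatrix z ->
  \sum_s S (z i s) * z s j = (i == j)%:R.
Proof.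
move=> cz; rewrite -(@sw_comatrix _ (fun a b => S a * b)) //; try lin.
by rewrite (@sw_antil _ _ _ id) // cz.2 scaler_nat.
Qed.

Lemma comatrix_mul (I J : finType) (x : I -> I -> H) (y : J -> J -> H) :
  comatrix x -> comatrix y ->
  comatrix (fun a b : I * J => x a.1 b.1 * y a.2 b.2).
Proof.
move=> cx cy; apply: comatrix_of_conv => [f g [i i'] [j j']|[i i'] [j j']] /=; last first.
  by rewrite counitM cx.2 cy.2 -natrM mulnb xpair_eqE.
rewrite conv_sw swM; try lin.
rewrite (@sw_comatrix _ (fun a b => \sw_(c, d <- y i' j') ((f (a * c) : k) *: g (b * d)))) //;
  try lin.
rewrite -(pair_bigA _ (fun s t => (f (x i s * y i' t) : k) * g (x s j * y t j'))) /=.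
apply: eq_bigr => s _.
by rewrite (@sw_comatrix _ (fun c d => (f (x i s * c) : k) *: g (x s j * d))) //; lin.
Qed.

Lemma ch_mul (I J : finType) (x : I -> I -> H) (y : J -> J -> H) :
  ch (fun a b : I * J => x a.1 b.1 * y a.2 b.2) = ch x * ch y.
Proof. by rewrite /ch big_distrlr /= pair_big. Qed.

Lemma comatrix_enum (I : finType) (z : I -> I -> H) : comatrix z ->
  comatrix (fun i j : 'I_#|I| => z (enum_val i) (enum_val j)).
Proof.
move=> cz; split=> i j; last by rewrite cz.2 (inj_eq enum_val_inj).
by rewrite cz.1 (reindex _ (onW_bij _ (enum_val_bij I))).
Qed.

Lemma ch_enum (I : finType) (z : I -> I -> H) :
  ch (fun i j : 'I_#|I| => z (enum_val i) (enum_val j)) = ch z.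
Proof. by rewrite /ch [RHS](reindex _ (onW_bij _ (enum_val_bij I))). Qed.

Lemma evm_conv n (z : 'I_n -> 'I_n -> H) f g : comatrix z ->
  evm z (conv f g) = evm z f *m evm z g.
Proof.
move=> cz; apply/matrixP => i j; rewrite !mxE comatrix_conv //.
by apply: eq_bigr => s _; rewrite !mxE.
Qed.

Lemma evm_counit n (z : 'I_n -> 'I_n -> H) : comatrix z -> evm z eps = 1%:M.
Proof. by move=> cz; apply/matrixP => i j; rewrite !mxE cz.2. Qed.

Lemma comatrix_of_evm n (z : 'I_n -> 'I_n -> H) :
  (forall f g, evm z (conv f g) = evm z f *m evm z g) -> evm z eps = 1%:M ->
  comatrix z.
Proof.
move=> zM z1; apply: comatrix_of_conv => [f g i j|i j].
  have /matrixP/(_ i j) := zM f g; rewrite !mxE => ->.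
  by apply: eq_bigr => s _; rewrite !mxE.
by have /matrixP/(_ i j) := z1; rewrite !mxE.
Qed.

Lemma trace_evm n (z : 'I_n -> 'I_n -> H) f : \tr (evm z f) = f (ch z).
Proof. by rewrite /ch linear_sum; apply: eq_bigr => i _; rewrite mxE. Qed.

Definition mixm m n p (A : 'M[k]_(m, n)) (z : 'I_n -> 'I_n -> H) (B : 'M[k]_(n, p)) i j : H :=
  \sum_a \sum_b (A i a * B b j) *: z a b.

Lemma evm_mixm m n (A : 'M[k]_(m, n)) z (B : 'M[k]_(n, m)) f :
  evm (mixm A z B) f = A *m evm z f *m B.
Proof.
apply/matrixP => i j; rewrite !mxE linear_sum /=.
transitivity (\sum_a \sum_b A i a * (f (z a b) : k) * B b j).
  apply: eq_bigr => a _; rewrite linear_sum; apply: eq_bigr => b _.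
  by rewrite linearZ /= /GRing.scale /= mulrAC.
rewrite exchange_big; apply: eq_bigr => b _; rewrite mxE mulr_suml.
by apply: eq_bigr => a _; rewrite mxE.
Qed.

(** Matrices act on rows, so the row space of [G] is a stable subspace; [w] is the restriction, in
    the basis formed by the rows. *)
Lemma comatrix_sub m n (G : 'M[k]_(m, n)) z : comatrix z -> row_free G ->
  (forall f, (G *m evm z f <= G)%MS) ->
  exists w : 'I_m -> 'I_m -> H, comatrix w /\ forall f, evm w f *m G = G *m evm z f.
Proof.
move=> cz fG stG; exists (mixm G z (pinvmx G)).
have wG f : evm (mixm G z (pinvmx G)) f *m G = G *m evm z f.
  by rewrite evm_mixm mulmxKpV.
split=> //; apply: comatrix_of_evm => [f g|].
  by rewrite [LHS]evm_mixm evm_conv // mulmxA -wG -!mulmxA [G *m _]mulmxA -evm_mixm.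
by rewrite evm_mixm evm_counit // mulmx1 mulmxVp.
Qed.

(** The quotient by the subrepresentation [w] is realised on a linear complement, and the trace is
    additive. *)
Lemma comatrix_quot m n (G : 'M[k]_(m, n)) z (w : 'I_m -> 'I_m -> H) :
  comatrix z -> comatrix w -> row_free G ->
  (forall f, evm w f *m G = G *m evm z f) ->
  exists p (y : 'I_p -> 'I_p -> H), [/\ (m + p = n)%N, comatrix y & ch z = ch w + ch y].
Proof.
move=> cz cw fG wG.
pose A := <<G>>%MS; pose B := (A^C)%MS; pose C := row_base B.
have AB0 : (A :&: B = 0)%MS := capmx_compl _.
have BA0 : (B :&: A = 0)%MS by rewrite capmxC.
have GA : (G <= A)%MS by rewrite genmxE.
have CB : (C <= B)%MS by rewrite eq_row_base.
have fC : row_free C := row_base_free _.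
pose P1 := proj_mx A B *m pinvmx G; pose P2 := proj_mx B A *m pinvmx C.
have P1G : P1 *m G = proj_mx A B.
  by rewrite mulmxKpV // -(genmxE G) -[proj_mx A B]mul1mx proj_mx_sub.
have P2C : P2 *m C = proj_mx B A.
  by rewrite mulmxKpV // eq_row_base -[proj_mx B A]mul1mx proj_mx_sub.
have GP1 : G *m P1 = 1%:M by rewrite mulmxA proj_mx_id // mulmxVp.
have GP2 : G *m P2 = 0 by rewrite mulmxA proj_mx_0 // mul0mx.
have CP2 : C *m P2 = 1%:M by rewrite mulmxA proj_mx_id // mulmxVp.
have P12 : P1 *m G + P2 *m C = 1%:M.
  rewrite P1G P2C -[proj_mx A B]mul1mx -[proj_mx B A]mul1mx add_proj_mx //.
  by rewrite submx_full // addsmx_compl_full.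
clearbody P1 P2 C; pose y := mixm C z P2.
have yE f : evm y f = C *m evm z f *m P2 := evm_mixm _ _ _ _.
have zP2 f : evm z f *m P2 = P2 *m evm y f.
  rewrite -[LHS]mul1mx -P12 mulmxDl yE -!mulmxA (mulmxA G) -wG -mulmxA GP2.
  by rewrite !mulmx0 add0r !mulmxA.
exists (\rank B), y; split.
- by rewrite mxrank_compl genmxE (eqnP fG) subnKC // -(eqnP fG) rank_leq_col.
- apply: comatrix_of_evm => [f g|]; last by rewrite yE evm_counit // mulmx1.
  by rewrite yE evm_conv // -!mulmxA zP2 !mulmxA -yE.
apply: functional_eq => f; rewrite linearD -trace_evm /=.
rewrite -[evm z f]mulmx1 -P12 mulmxDr mxtraceD; congr (_ + _).
  by rewrite mulmxA mxtrace_mulC mulmxA -wG -mulmxA GP1 mulmx1 trace_evm.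
by rewrite mulmxA mxtrace_mulC mulmxA -yE trace_evm.
Qed.

Definition irr_comatrix n (z : 'I_n -> 'I_n -> H) : Prop :=
  [/\ comatrix z, (0 < n)%N
    & forall U : 'M[k]_n, (forall f, stablemx U (evm z f)) ->
        \rank U = 0 \/ \rank U = n].

Lemma dual_reprE n (z : 'I_n -> 'I_n -> H) :
  exists rho : {linear 'Hom(H, k^o) -> 'M[k]_n}, rho =1 evm z.
Proof.
have lz : linear (evm z).
  by move=> a f g; apply/matrixP => i j; rewrite !mxE add_lfunE scale_lfunE.
pose m := GRing.isLinear.Build _ _ _ _ _ lz.
by exists (HB.pack (evm z) m : {linear 'Hom(H, k^o) -> 'M[k]_n}).
Qed.

Lemma dual_repr_coef n (rho : {linear 'Hom(H, k^o) -> 'M[k]_n}) :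
  exists z : 'I_n -> 'I_n -> H, evm z =1 rho.
Proof.
exists (fun i j => \sum_(t < \dim {:H}) rho (dual_basis t) i j *: (vbasis {:H})`_t) => f.
have ef : f = \sum_(t < \dim {:H}) (f (vbasis {:H})`_t : k) *: dual_basis t.
  apply/lfunP => u; rewrite sum_lfunE {1}(coord_vbasis (memvf u)) linear_sum.
  apply: eq_bigr => i _.
  by rewrite linearZ scale_lfunE dual_basisE /= /GRing.scale /= mulrC.
apply/matrixP => i j; rewrite {2}ef mxE !linear_sum summxE; apply: eq_bigr => t _.
by rewrite !linearZ mxE /= /GRing.scale /= mulrC.
Qed.

Lemma dual_charP d : dual_char d <->
  exists n (z : 'I_n -> 'I_n -> H), comatrix z /\ d = ch z.
Proof.
split=> [[n [rho [[r1 rM] dr]]]|[n [z [cz ->]]]].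
  have [z ez] := dual_repr_coef rho; exists n, z; split.
    by apply: comatrix_of_evm => [f g|]; rewrite !ez.
  by apply: functional_eq => f; rewrite dr -trace_evm ez.
have [rho er] := dual_reprE z; exists n, rho; split; last first.
  by move=> f; rewrite er trace_evm.
by split=> [|f g]; rewrite !er ?evm_counit ?evm_conv.
Qed.

Lemma irr_dual_charP d : irr_dual_char d <->
  exists n (z : 'I_n -> 'I_n -> H), irr_comatrix z /\ d = ch z.
Proof.
split=> [[n [rho [[[r1 rM] n0 rirr] dr]]]|[n [z [[cz n0 zirr] ->]]]].
  have [z ez] := dual_repr_coef rho; exists n, z; split; last first.
    by apply: functional_eq => f; rewrite dr -trace_evm ez.
  split=> //; first by apply: comatrix_of_evm => [f g|]; rewrite !ez.
  by move=> U stU; apply: rirr => f; rewrite -ez.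
have [rho er] := dual_reprE z; exists n, rho; split; last first.
  by move=> f; rewrite er trace_evm.
split=> //; first by split=> [|f g]; rewrite !er ?evm_counit ?evm_conv.
by move=> U stU; apply: zirr => f; rewrite -er.
Qed.

Lemma ch_dual_char (I : finType) (z : I -> I -> H) : comatrix z -> dual_char (ch z).
Proof.
move=> cz; apply/dual_charP; exists #|I|, (fun i j => z (enum_val i) (enum_val j)).
by split; [exact: comatrix_enum | rewrite ch_enum].
Qed.

Section Decomposition.
Variables (N : nat) (irr : N.-tuple H).
Hypothesis hirr : irr_enum irr.

(** Induction on the dimension: the trace is additive on a subrepresentation and its quotient, so a
    composition series suffices. *)
Lemma comatrix_decomp n (z : 'I_n -> 'I_n -> H) : comatrix z ->
  exists m : 'I_N -> nat, ch z = \sum_i (m i)%:R *: irr`_i.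
Proof.
have [b] := ubnP n; elim: b n z => // b IHb n z; rewrite ltnS => nb cz.
have [n0|n0] := posnP n.
  exists (fun=> 0%N); rewrite /ch big1 => [|i _]; last by have := ltn_ord i; rewrite [X in (_ < X)%N]n0 ltn0.
  by rewrite big1 // => i _; rewrite scale0r.
have [zirr|nirr] := EM (irr_comatrix z).
  have chirr : ch z \in irr.
    by apply/hirr.2/irr_dual_charP; exists n, z.
  have iN : (index (ch z) irr < N)%N by rewrite -{2}(size_tuple irr) index_mem.
  exists (fun i => (i == Ordinal iN) : nat).
  rewrite (bigD1 (Ordinal iN)) //= eqxx scale1r nth_index // big1 ?addr0 // => i ni.
  by rewrite (negPf ni) scale0r.
have [U [stU [U0 Un]]] : exists U : 'M[k]_n, (forall f, stablemx U (evm z f)) /\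
    (\rank U <> 0%N /\ \rank U <> n).
  apply: contrapT => noU; apply: nirr; split=> // U stU.
  apply: contrapT => /not_orP[U0 Un]; apply: noU; exists U; split=> //.
pose G := row_base U.
have fG : row_free G := row_base_free _.
have stG f : (G *m evm z f <= G)%MS.
  by rewrite eq_row_base; apply: submx_trans (stU f); rewrite submxMr // eq_row_base.
have [w [cw wG]] := comatrix_sub cz fG stG.
have [p [y [mp cy ->]]] := comatrix_quot cz cw fG wG.
have rn : (\rank U < n)%N by rewrite ltn_neqAle rank_leq_row andbT; apply/eqP.
have pn : (p < n)%N by rewrite -mp -[X in (X < _)%N]add0n ltn_add2r lt0n; apply/eqP.
have [m1 ->] := IHb _ w (leq_trans rn nb) cw.
have [m2 ->] := IHb _ y (leq_trans pn nb) cy.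
exists (fun i => m1 i + m2 i)%N; rewrite -big_split; apply: eq_bigr => i _.
by rewrite natrD scalerDl.
Qed.

End Decomposition.
End Comatrix.

(** * Schur's lemma and the orthogonality relations *)

Section Schur.
Variables (k : numClosedFieldType) (H : hopfType k).
Variables (p q : nat) (z : 'I_p -> 'I_p -> H) (y : 'I_q -> 'I_q -> H).
Hypothesis zirr : irr_comatrix z.

Lemma schur_free (F : 'M[k]_(p, q)) :
  (forall f, evm z f *m F = F *m evm y f) -> F != 0 -> row_free F.
Proof.
have [_ _ irr] := zirr; move=> zF F0.
have [f|kF|kF] := irr (kermx F).
- by rewrite sub_kermx -mulmxA zF mulmxA mulmx_ker mul0mx.
- by rewrite -kermx_eq0 -mxrank_eq0 kF.
have: (1%:M <= kermx F)%MS by rewrite sub1mx /row_full kF.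
by rewrite sub_kermx mul1mx (negPf F0).
Qed.

Lemma schur_full (F : 'M[k]_(p, q)) : irr_comatrix y ->
  (forall f, evm z f *m F = F *m evm y f) -> F != 0 -> row_full F.
Proof.
move=> [_ _ irr] zF F0; rewrite /row_full -genmxE.
have [f|/eqP|->] := irr <<F>>%MS; last by [].
  apply: (submx_trans (submxMr _ (_ : (<<F>> <= F)%MS))); first by rewrite genmxE.
  by rewrite genmxE -zF submxMl.
by rewrite genmxE mxrank_eq0 (negPf F0).
Qed.

End Schur.

Section Orthogonality.
Variables (k : numClosedFieldType) (H : hopfType k).
Local Notation S := (@antipode k H).
Local Notation eps := (@counit k H).
Local Notation chi := (@reg_char k H).
Implicit Types (f g u : 'Hom(H, k^o)).

Lemma schur_ch p q (z : 'I_p -> 'I_p -> H) (y : 'I_q -> 'I_q -> H) (F : 'M[k]_(p, q)) :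
  irr_comatrix z -> irr_comatrix y ->
  (forall f, evm z f *m F = F *m evm y f) -> F != 0 -> ch z = ch y.
Proof.
move=> zirr yirr zF F0.
have fF := schur_free zirr zF F0; have FF := schur_full yirr zF F0.
apply: functional_eq => f; rewrite -!trace_evm.
rewrite -[evm z f]mulmx1 -(mulmxVp fF) mulmxA zF mxtrace_mulC mulmxA.
by rewrite mulVpmx // mul1mx.
Qed.

(** F minus one of its eigenvalues is an intertwiner that is not injective, so it vanishes. *)
Lemma schur_scalar p (z : 'I_p -> 'I_p -> H) (F : 'M[k]_p) : irr_comatrix z ->
  (forall f, evm z f *m F = F *m evm z f) -> exists a, F = a%:M.
Proof.
move=> zirr zF; have [_ p0 _] := zirr.
have [a Fa] := eigenvalue_closed F p0; exists a; apply/eqP; rewrite -subr_eq0.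
apply: contraTT Fa => Fa; rewrite /eigenvalue /eigenspace negbK kermx_eq0.
apply: (schur_free zirr _ Fa) => f.
by rewrite mulmxBr mulmxBl zF scalar_mxC.
Qed.

Hypothesis SS : forall x : H, S (S x) = x.
Hypothesis chi_int : forall u, conv chi u = (u 1 : k) *: chi.
Hypothesis chiS : forall x, chi (S x) = chi x.

(* Averaging over the integral chi: chi (S(z) E y) intertwines z and y for every matrix unit E. *)
Lemma intertwiner p q (z : 'I_p -> 'I_p -> H) (y : 'I_q -> 'I_q -> H) j l f :
  comatrix z -> comatrix y ->
  let F := \matrix_(i, t) (chi (S (z i j) * y l t) : k) in
  evm z f *m F = F *m evm y f.
Proof.
move=> cz cy F; apply/matrixP => r t; rewrite !mxE.
(* The integral property of chi at S(z_ij) y_lt, multiplied by z_ri; summing over i then leaves only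
   s = r. *)
have key i : \sum_s \sum_u ((chi (S (z s j) * y l u) : k) *: f (z r i * (S (z i s) * y u t))) =
    ((chi (S (z i j) * y l t) : k) *: f (z r i)).
  rewrite -[z r i in RHS]mulr1.
  rewrite -(@sw_chi _ _ chi_int _ (fun v => f (z r i * v))); last lin.
  rewrite swM; try lin.
  rewrite (@sw_antipode _ _ _ (fun a b => \sw_(c, d <- y l t)
    ((chi (a * c) : k) *: f (z r i * (b * d))))); try lin.
  rewrite (@sw_comatrix _ _ _ (fun b a => \sw_(c, d <- y l t)
    ((chi (S a * c) : k) *: f (z r i * (S b * d))))) //; try lin.
  apply: eq_bigr => s _.
  rewrite (@sw_comatrix _ _ _ (fun c d => (chi (S (z s j) * c) : k) *: f (z r i * (S (z i s) * d)))) //.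
  - by lin.
  - by lin.
transitivity (\sum_i ((chi (S (z i j) * y l t) : k) *: f (z r i) : k^o)).
  by apply: eq_bigr => i _; rewrite !mxE mulrC.
under eq_bigr => i _ do rewrite -key.
rewrite exchange_big (bigD1 r) //= [X in _ + X]big1 ?addr0 => [|s sr].
  rewrite exchange_big; apply: eq_bigr => u _; rewrite !mxE -scaler_sumr; congr (_ * _).
  under eq_bigr => i _ do rewrite mulrA.
  by rewrite -linear_sum -mulr_suml comatrix_antir // eqxx mul1r.
rewrite exchange_big big1 // => u _; rewrite -scaler_sumr.
under eq_bigr => i _ do rewrite mulrA.
by rewrite -linear_sum -mulr_suml comatrix_antir // eq_sym (negPf sr) mul0r linear0 scaler0.
Qed.

Lemma coef_orthogonal p q (z : 'I_p -> 'I_p -> H) (y : 'I_q -> 'I_q -> H) i j l t :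
  irr_comatrix z -> irr_comatrix y -> ch z <> ch y -> chi (S (z i j) * y l t) = 0.
Proof.
move=> zirr yirr zy; have [cz _ _] := zirr; have [cy _ _] := yirr.
have zF f := intertwiner j l f cz cy.
have [/matrixP/(_ i t)|F0] := eqVneq (\matrix_(i, t) (chi (S (z i j) * y l t) : k)) 0.
  by rewrite !mxE.
by have := schur_ch zirr yirr zF F0.
Qed.

(** By Schur's lemma the value is a_jl when i = t and 0 otherwise; invariance of chi under S makes
    a_jl scalar, and the antipode identity gives p a_jj = chi(1). *)
Lemma coef_orthonormal p (z : 'I_p -> 'I_p -> H) i j l t : irr_comatrix z ->
  chi (S (z i j) * z l t) = ((i == t) && (j == l))%:R * (chi 1 / p%:R) :> k.
Proof.
move=> zirr; have [cz p0 _] := zirr.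
pose i0 := Ordinal p0; pose a j l : k := chi (S (z i0 j) * z l i0).
have ea i' j' l' t' : chi (S (z i' j') * z l' t') = (i' == t')%:R * a j' l' :> k.
  have [c Fc] := schur_scalar zirr (fun f => intertwiner j' l' f cz cz).
  have /matrixP/(_ i0 i0) := Fc; rewrite !mxE eqxx mulr1n -/(a _ _) => ->.
  by have /matrixP/(_ i' t') := Fc; rewrite !mxE => ->; rewrite mulr_natl.
have sym i' j' l' t' : (i' == t')%:R * a j' l' = (l' == j')%:R * a t' i'.
  by rewrite -!ea -chiS antipodeM SS.
have aii s : a s s = a j j by have := sym s j j s; rewrite !eqxx !mul1r => ->.
have pa : p%:R * a j j = chi 1 :> k.
  transitivity (chi (\sum_s S (z i0 s) * z s i0) : k); last by rewrite comatrix_antil // eqxx.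
  rewrite linear_sum (eq_bigr (fun=> a j j : k^o)) => [|s _].
    by rewrite sumr_const card_ord mulr_natl.
  by rewrite /= ea eqxx mul1r aii.
rewrite ea -pa mulrAC mulfV ?mul1r ?pnatr_eq0 -?lt0n //.
case: (i == t) => /=; rewrite ?mul0r // mul1r.
have := sym i j l i; rewrite eqxx mul1r => ->; rewrite eq_sym.
by case: eqVneq => [_|]; rewrite ?mul0r // !mul1r aii.
Qed.

Lemma ch_orthogonal p q (z : 'I_p -> 'I_p -> H) (y : 'I_q -> 'I_q -> H) :
  irr_comatrix z -> irr_comatrix y -> ch z <> ch y -> chi (S (ch z) * ch y) = 0.
Proof.
move=> zirr yirr zy; rewrite /ch linear_sum mulr_suml linear_sum big1 // => i _.
rewrite mulr_sumr linear_sum big1 // => j _; exact: coef_orthogonal.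
Qed.

Lemma ch_orthonormal p (z : 'I_p -> 'I_p -> H) :
  irr_comatrix z -> chi (S (ch z) * ch z) = chi 1.
Proof.
move=> zirr; have [_ p0 _] := zirr.
rewrite /ch linear_sum mulr_suml linear_sum /=.
transitivity (\sum_(i < p) (chi 1 / p%:R : k)).
  apply: eq_bigr => i _; rewrite mulr_sumr linear_sum (bigD1 i) //= big1 ?addr0.
    by rewrite coef_orthonormal // eqxx mul1r.
  by move=> j ji; rewrite coef_orthonormal // eq_sym (negPf ji) mul0r.
by rewrite sumr_const card_ord -[LHS]mulr_natr mulfVK // pnatr_eq0 -lt0n.
Qed.

Section Enum.
Variables (N : nat) (irr : N.-tuple H).
Hypothesis hirr : irr_enum irr.

Lemma irr_nth (i : 'I_N) : exists n (z : 'I_n -> 'I_n -> H), irr_comatrix z /\ irr`_i = ch z.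
Proof. by apply/irr_dual_charP/hirr.2; rewrite mem_nth ?size_tuple. Qed.

Lemma irr_eq (i j : 'I_N) : (irr`_i == irr`_j) = (i == j).
Proof. by have [u _] := hirr; rewrite nth_uniq ?size_tuple. Qed.

Lemma irr_orthonormal (i j : 'I_N) : chi (S irr`_i * irr`_j) = (i == j)%:R * chi 1 :> k.
Proof.
have [p [z [zirr ez]]] := irr_nth i; have [q [y [yirr ey]]] := irr_nth j.
case: eqVneq => [ij|ij]; first by rewrite -ij ez ch_orthonormal // mul1r.
rewrite ez ey ch_orthogonal ?mul0r // -ez -ey => /eqP.
by rewrite irr_eq (negPf ij).
Qed.

Lemma irr_coef (c : 'I_N -> k) (j : 'I_N) :
  chi (S irr`_j * \sum_i c i *: irr`_i) = c j * chi 1 :> k.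
Proof.
rewrite mulr_sumr linear_sum (bigD1 j) //= big1 ?addr0.
  by rewrite -scalerAr linearZ /= irr_orthonormal eqxx mul1r.
move=> i ij; rewrite -scalerAr linearZ /= irr_orthonormal eq_sym (negPf ij).
by rewrite mul0r scaler0.
Qed.

Lemma irr_free : free irr.
Proof.
apply/freeP => c c0 j; have := irr_coef c j; rewrite c0 mulr0 linear0 => /esym/eqP.
by rewrite mulf_eq0 [chi 1 == 0]gt_eqF ?reg_char1_gt0 ?orbF // => /eqP.
Qed.

Lemma irr_basis : basis_of (char_ring H) irr.
Proof.
rewrite /basis_of irr_free andbT eqEsubv; have [chR chMin] := char_ringP H.
apply/andP; split.
  apply/span_subvP => d /hirr.2 /irr_dual_charP[n [z [[cz _ _] ->]]].
  by apply/chR/ch_dual_char.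
apply: chMin => d /dual_charP[n [z [cz ->]]].
have [m ->] := comatrix_decomp hirr cz; apply: memv_suml => i _.
by rewrite memvZ // memv_span // mem_nth ?size_tuple.
Qed.

(* A subcoalgebra contains the coefficients of every irreducible character that
   occurs in one of its elements: they are cut out by the functionals chi (S x _). *)
Lemma coef_in_subcoalg (D : {vspace H}) (c : 'I_N -> k) (j : 'I_N) n (z : 'I_n -> 'I_n -> H) :
  (forall v f, v \in D -> comul v f \in D) ->
  \sum_i c i *: irr`_i \in D -> c j != 0 -> irr_comatrix z -> irr`_j = ch z ->
  forall a b, z a b \in D.
Proof.
move=> DD cD cj zirr ez a b; have [cz n0 _] := zirr.
pose phi : 'Hom(H, k^o) := linfun (fun x => chi (S (z a b) * x)).
have phiE x : phi x = chi (S (z a b) * x) by rewrite lin_linfunE //; lin.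
have comul_phi m (y : 'I_m -> 'I_m -> H) : comatrix y ->
    comul (ch y) phi = \sum_s \sum_t (phi (y s t) : k) *: y t s.
  move=> cy; rewrite /ch linear_sum sum_lfunE; apply: eq_bigr => s _ /=.
  by rewrite cy.1 sum_lfunE; apply: eq_bigr => t _; rewrite tensE.
have := DD _ phi cD; rewrite linear_sum sum_lfunE (bigD1 j) //= big1 ?addr0; last first.
  move=> i ij; have [m [y [yirr ey]]] := irr_nth i.
  have [cy _ _] := yirr; rewrite linearZ scale_lfunE ey comul_phi //.
  rewrite big1 ?scaler0 // => s _; rewrite big1 // => t _.
  rewrite phiE coef_orthogonal ?scale0r // -ez -ey => /eqP.
  by rewrite irr_eq eq_sym (negPf ij).
rewrite linearZ scale_lfunE ez comul_phi // (bigD1 b) //= [X in _ + X]big1 ?addr0; last first.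
  move=> s sb; rewrite big1 // => t _.
  by rewrite phiE coef_orthonormal // [b == s]eq_sym (negPf sb) andbF mul0r scale0r.
rewrite (bigD1 a) //= big1 ?addr0; last first.
  move=> t ta; rewrite phiE coef_orthonormal // [a == t]eq_sym (negPf ta) mul0r scale0r //.
rewrite phiE coef_orthonormal // !eqxx mul1r scalerA => zD.
have cc : c j * (chi 1 / n%:R) != 0 :> k.
  by rewrite mulf_neq0 ?mulf_neq0 ?invr_eq0 ?pnatr_eq0 -?lt0n // gt_eqF // reg_char1_gt0.
by have := memvZ (c j * (chi 1 / n%:R))^-1 zD; rewrite scalerA mulVf // scale1r.
Qed.

End Enum.
End Orthogonality.

(** * The operator T *)

Lemma free_dual (k : fieldType) (V : vectType k) (I : eqType) (s : seq I)
    (e : I -> V) (phi : I -> V -> k^o) : uniq s -> (forall i, lin (phi i)) ->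
  (forall i, i \in s -> phi i (e i) != 0) ->
  {in s &, forall i j, i != j -> phi i (e j) = 0} -> free [seq e i | i <- s].
Proof.
move=> + lphi; elim: s => [|i s IHs] /=; first by rewrite nil_free.
move=> /andP[iNs us] d0 od; rewrite free_cons IHs ?andbT //.
- apply: contraL (d0 i (mem_head _ _)) => ei; rewrite negbK.
  pose F := linfun (phi i); have FE x : F x = phi i x by rewrite lin_linfunE.
  rewrite -FE -memv_ker; move: (e i) ei; apply/subvP/span_subvP => _ /mapP[j js ->].
  rewrite memv_ker FE od ?mem_head ?inE ?js ?orbT //.
  by apply: contraNneq iNs => ->.
- by move=> j js; apply: d0; rewrite inE js orbT.
by move=> j l js ls; apply: od; rewrite inE ?js ?ls orbT.
Qed.

(** * A Perron-Frobenius argument for symmetric nonnegative matrices *)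

Section Perron.
Variables (k : numClosedFieldType) (N : nat) (m : 'I_N -> 'I_N -> k) (lam : k).
Variables (e v : 'I_N -> k).
Hypotheses (m_ge0 : forall i j, 0 <= m i j) (m_sym : forall i j, m i j = m j i).
Hypotheses (e_gt0 : forall i, 0 < e i) (me : forall i, \sum_j m i j * e j = lam * e i).
Hypothesis mv : forall i, \sum_j m i j * v j = lam * v i.

(* The quadratic form sum m_ij e_i e_j |v_i / e_i - v_j / e_j|^2 vanishes. *)
Lemma perron_const i j : m i j != 0 -> v i / e i = v j / e j.
Proof.
pose y i := v i / e i.
have ev i' : v i' = e i' * y i' by rewrite mulrC divfK // gt_eqF.
pose t i j := m i j * e i * e j * `|y i - y j| ^+ 2.
have t_ge0 i' j' : 0 <= t i' j'.
  by rewrite !mulr_ge0 ?exprn_ge0 ?normr_ge0 // ltW.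
(* Expanding |y_i - y_j|^2 gives four sums; by symmetry and the two eigenvector equations each
   equals [q]. *)
pose q := \sum_i lam * (e i * e i) * (y i * (y i)^*).
have s1 : \sum_i \sum_j m i j * e i * e j * (y i * (y i)^*) = q.
  apply: eq_bigr => i' _; rewrite [lam * _]mulrA -me !mulr_suml; apply: eq_bigr => j' _.
  by rewrite [_ * e j' * e i']mulrAC.
have s2 : \sum_i \sum_j m i j * e i * e j * (y j * (y j)^*) = q.
  rewrite exchange_big -s1; apply: eq_bigr => i' _; apply: eq_bigr => j' _.
  by rewrite m_sym -!mulrA [e j' * _]mulrCA !mulrA.
have s3 : \sum_i \sum_j m i j * e i * e j * (y j * (y i)^*) = q.
  apply: eq_bigr => i' _.
  transitivity (\sum_j (m i' j * v j) * (e i' * (y i')^*)).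
    apply: eq_bigr => j' _; rewrite ev; ring.
  rewrite -mulr_suml mv ev; ring.
have s4 : \sum_i \sum_j m i j * e i * e j * (y i * (y j)^*) = q.
  rewrite exchange_big -s3; apply: eq_bigr => i' _; apply: eq_bigr => j' _.
  by rewrite m_sym -!mulrA [e j' * _]mulrCA !mulrA.
have t0 : \sum_i \sum_j t i j = 0.
  transitivity (q - q - (q - q)); last by rewrite !subrr.
  rewrite -{1}s1 -{1}s3 -{1}s4 -s2 -!sumrB; apply: eq_bigr => i' _.
  rewrite -!sumrB; apply: eq_bigr => j' _.
  rewrite /t normCK rmorphB; ring.
move=> mij; apply/eqP; rewrite -subr_eq0 -/(y i) -/(y j).
have sj_ge0 i' : 0 <= \sum_j t i' j by rewrite sumr_ge0.
have /(_ i isT) := psumr_eq0P (fun i _ => sj_ge0 i) t0.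
move=> /(psumr_eq0P (fun j _ => t_ge0 i j)) /(_ j isT)/eqP.
by rewrite /t mulf_eq0 expf_eq0 /= normr_eq0 !mulf_eq0 (negPf mij) !(gt_eqF (e_gt0 _)).
Qed.

End Perron.

(** * Left coideals and coefficient spaces *)

Section Subcoalgebras.
Variables (k : fieldType) (H : hopfType k).
Local Notation S := (@antipode k H).
Local Notation eps := (@counit k H).
Implicit Types (f g u : 'Hom(H, k^o)).

Definition left_coideal (D : {vspace H}) := forall v f, v \in D -> comul v f \in D.

Lemma left_coidealM (A B : {vspace H}) :
  left_coideal A -> left_coideal B -> left_coideal (A * B)%VS.
Proof.
move=> cA cB v f; pose F := linfun (fun v : H => comul v f).
have FE x : F x = comul x f.
  by rewrite lin_linfunE // => a u w; rewrite linearP add_lfunE scale_lfunE.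
rewrite -FE memv_preim; move: v; apply/subvP/prodvP => a b aA bB.
rewrite -memv_preim FE comulE swM; try lin.
apply: memv_suml => i _; apply: memv_suml => j _.
by rewrite memvZ // memv_mul ?cA ?cB.
Qed.

(** The smallest left coideal containing d. It describes C_d from d alone, without a choice of
    matrix coefficients. *)
Definition coef_space (d : H) : {vspace H} := limg (comul d).

Lemma left_coideal_coef d : left_coideal (coef_space d).
Proof. by move=> _ f /memv_imgP[g _ ->]; rewrite -comul_conv memv_img ?memvf. Qed.

Lemma mem_coef_space d : d \in coef_space d.
Proof. by rewrite -{1}(counitl d) -comulE memv_img ?memvf. Qed.

Lemma coef_space_sub (I : finType) (z : I -> I -> H) (D : {vspace H}) : comatrix z ->
  (forall i j, z i j \in D) -> (coef_space (ch z) <= D)%VS.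
Proof.
move=> cz zD; apply/subvP => _ /memv_imgP[f _ ->].
rewrite /ch linear_sum sum_lfunE; apply: memv_suml => i _ /=.
by rewrite cz.1 sum_lfunE; apply: memv_suml => j _; rewrite tensE memvZ.
Qed.

(** The functional dual to x_ba, applied to the first leg of the coproduct of the sum of the x_ii,
    returns x_ab. *)
Lemma subcoalg_of_coef d C : subcoalg_of d C -> C = coef_space d.
Proof.
move=> [q [x [bC cx -> ex]]].
pose T := ('I_q * 'I_q)%type.
pose X := [tuple of [seq x ij.1 ij.2 | ij : T]].
have fX : free X := basis_free bC.
have Xnth (ij : T) : x ij.1 ij.2 = X`_(enum_rank ij).
  by rewrite (nth_map ij) ?nth_enum_rank // -cardE.
have comul_d f : comul (\sum_i x i i) f = \sum_i \sum_s (f (x i s) : k) *: x s i.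
  rewrite linear_sum sum_lfunE; apply: eq_bigr => i _ /=.
  by rewrite cx sum_lfunE; apply: eq_bigr => s _; rewrite tensE.
have xC (ij : T) : x ij.1 ij.2 \in C.
  by apply: (basis_mem bC); apply/mapP; exists ij; rewrite ?mem_enum.
apply/eqP; rewrite eqEsubv; apply/andP; split; last first.
  apply/subvP => _ /memv_imgP[f _ ->]; rewrite comul_d.
  by apply: memv_suml => i _; apply: memv_suml => s _; rewrite memvZ // (xC (s, i)).
rewrite -(span_basis bC); apply/span_subvP => _ /mapP[[a b] _ ->] /=.
pose f : 'Hom(H, k^o) := linfun (coord X (enum_rank (b, a)) : H -> k^o).
have fE (ij : T) : f (x ij.1 ij.2) = (ij == (b, a))%:R.
  by rewrite lfunE /= Xnth coord_free // (inj_eq enum_rank_inj).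
apply/memv_imgP; exists f; rewrite ?memvf // comul_d.
rewrite (bigD1 b) //= (bigD1 a) //= (fE (b, a)) eqxx scale1r.
rewrite [X in _ + X + _]big1 => [|s sa]; last first.
  by rewrite (fE (b, s)) xpair_eqE (negPf sa) andbF scale0r.
rewrite big1 ?addr0 // => i ib; rewrite big1 // => s _.
by rewrite (fE (i, s)) xpair_eqE (negPf ib) scale0r.
Qed.

End Subcoalgebras.

Section RegularComatrix.
Variables (k : numClosedFieldType) (H : hopfType k).
Local Notation S := (@antipode k H).
Local Notation eps := (@counit k H).
Local Notation chi := (@reg_char k H).
Hypothesis SS : forall x : H, S (S x) = x.
Hypothesis chi_int : forall u, conv chi u = (u 1 : k) *: chi.
Variables (K : {aspace H}) (LK : H).
Hypotheses (hK : hopf_subalgebra K) (intK : hopf_integral K LK)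
  (epsK : counit LK = (\dim K)%:R :> k).

(** [x] is the coefficient matrix of K as a comodule, whose trace is found in [trace_coideal]. The
    last clause says that its entries span at least K, in the dual form suited to products. *)
Lemma hopf_comatrix : exists x : 'I_(\dim K) -> 'I_(\dim K) -> H,
  [/\ comatrix x, ch x = LK &
    forall psi : 'Hom(H, k^o), (forall i j, psi (x i j) = 0) ->
      forall y, y \in K -> psi y = 0].
Proof.
have lf (f : 'Hom(H, k^o)) : lin (fun y : H => comul y f).
  by move=> a u v; rewrite linearP add_lfunE scale_lfunE.
pose x (i j : 'I_(\dim K)) : H :=
  \sw_(a, b <- (vbasis K)`_i) ((coord (vbasis K) j b : k) *: a).
have xE i j (f : 'Hom(H, k^o)) : f (x i j) = coord (vbasis K) j (comul (vbasis K)`_i f).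
  rewrite /x comulE (@lin_tliftE _ _ _ _ _ f); last lin.
  have lc : lin (fun z : H => coord (vbasis K) j z : k^o) by move=> a u v; rewrite linearP.
  rewrite (@lin_tliftE _ _ _ _ _ (fun z : H => coord (vbasis K) j z : k^o)) //.
  by apply: eq_tlift => a b; rewrite !linearZ /= /GRing.scale /= mulrC.
have evx f : evm x f = mxv K (fun y => comul y f).
  by apply/matrixP => i j; rewrite !mxE xE.
have Ki (i : 'I_(\dim K)) : (vbasis K)`_i \in K.
  by rewrite vbasis_mem // mem_nth ?size_tuple.
exists x; split.
- apply: comatrix_of_evm => [f g|].
    rewrite !evx -mxv_comp //; last by move=> y yK; apply: hopf_comul.
    by apply: eq_mxv => y _; rewrite /= comul_conv.
  by rewrite evx -mxv_id; apply: eq_mxv => y _; rewrite comulE counitl.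
- apply: functional_eq => f; rewrite -trace_evm evx mxv_trace.
  exact: (trace_coideal SS chi_int hK intK epsK).
move=> psi psi0 y yK; rewrite (coord_vbasis yK) linear_sum big1 // => i _.
rewrite linearZ /= -counit_comul.
rewrite (coord_vbasis (hopf_comul hK _ (Ki i))) linear_sum big1 ?scaler0 // => j _.
by rewrite linearZ /= -xE psi0 scale0r.
Qed.

End RegularComatrix.

(** * Multiplicities, equivalence classes and the eigenspace *)

Section Main.
Variables (k : numClosedFieldType) (H : hopfType k).
Local Notation S := (@antipode k H).
Local Notation eps := (@counit k H).
Local Notation chi := (@reg_char k H).
Implicit Types (f g u : 'Hom(H, k^o)).

Lemma grouplike_irr (g : H) : grouplike g -> irr_dual_char g.
Proof.
move=> gg; apply/irr_dual_charP; exists 1%N, (fun _ _ => g); split; last first.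
  by rewrite /ch big_ord1.
split=> //; last by move=> U _; case: (\rank U) (rank_leq_row U) => [|[|]]; auto.
by split=> i j; rewrite ?big_ord1 ?gg.1 ?gg.2 // !ord1 eqxx.
Qed.

Variables (N : nat) (irr : N.-tuple H).
Hypothesis hirr : irr_enum irr.
Hypothesis SS : forall x : H, S (S x) = x.
Hypothesis chi_int : forall u, conv chi u = (u 1 : k) *: chi.
Hypothesis chiS : forall x, chi (S x) = chi x.

Lemma left_coideal_hopf (A : {aspace H}) : hopf_subalgebra A -> left_coideal A.
Proof. by move=> hA v f; apply: hopf_comul. Qed.

Lemma irr_subcoalg (i : 'I_N) : subcoalg_of irr`_i (coef_space irr`_i).
Proof.
have [n [z [zirr ez]]] := irr_nth hirr i; have [cz n0 _] := zirr.
pose C : {vspace H} := <<[seq z ij.1 ij.2 | ij : 'I_n * 'I_n]>>%VS.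
suff sC : subcoalg_of irr`_i C by rewrite -(subcoalg_of_coef sC).
exists n, (\matrix_(a, b) z a b); split.
- have -> : [seq (\matrix_(a, b) z a b) ij.1 ij.2 | ij : 'I_n * 'I_n] =
      [seq z ij.1 ij.2 | ij : 'I_n * 'I_n] by apply: eq_map => ij; rewrite mxE.
  rewrite /basis_of eqxx /=.
  (* Up to a factor, chi(S(z_ba) _) is the functional dual to z_ab, hence the exchanged indices. *)
  apply: (@free_dual _ _ _ _ _ (fun ij x => chi (S (z ij.2 ij.1) * x))).
  + exact: enum_uniq.
  + by move=> ij; lin.
  + move=> ij _; rewrite (coef_orthonormal SS chi_int chiS) // !eqxx mul1r.
    by rewrite mulf_neq0 ?invr_eq0 ?pnatr_eq0 -?lt0n // gt_eqF // reg_char1_gt0.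
  + move=> [a b] [a' b'] _ _; rewrite xpair_eqE negb_and => ab.
    rewrite (coef_orthonormal SS chi_int chiS) //.
    by case/orP: ab => /negPf ->; rewrite ?andbF mul0r.
- move=> a b; rewrite mxE cz.1; apply: eq_bigr => s _; rewrite !mxE //.
- by rewrite ez; apply: eq_bigr => a _; rewrite mxE.
by rewrite ez /ch linear_sum (eq_bigr (fun=> 1 : k^o)) => [|a _];
  rewrite /= ?cz.2 ?eqxx // sumr_const card_ord.
Qed.

Variables (K L : {aspace H}) (LK LL : H).
Hypotheses (hK : hopf_subalgebra K) (hL : hopf_subalgebra L).
Hypotheses (intK : hopf_integral K LK) (epsK : counit LK = (\dim K)%:R :> k).
Hypotheses (intL : hopf_integral L LL) (epsL : counit LL = (\dim L)%:R :> k).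

Let T := sandwich LK LL.
Let lambda : k := (\dim K * \dim L)%:R.
Let e (i : 'I_N) : H := irr`_i.
Let d (i : 'I_N) : k := eps (e i).

Lemma counit_irr_gt0 i : 0 < d i.
Proof.
rewrite /d /e; have [n [z [[cz n0 _] ->]]] := irr_nth hirr i.
rewrite /ch linear_sum (eq_bigr (fun=> 1 : k^o)) => [|j _]; last by rewrite /= cz.2 eqxx.
by rewrite sumr_const card_ord ltr0n.
Qed.

Lemma lambda_gt0 : 0 < lambda.
Proof. by rewrite ltr0n muln_gt0 !adim_gt0. Qed.

Lemma sandwich_idem x : T (T x) = lambda *: T x.
Proof.
rewrite !sandwichE !mulrA; have [LKK iK] := intK; have [LLL iL] := intL.
rewrite (iK _ LKK).1 -!mulrA (iL _ LLL).1 epsK epsL -!scalerAl -!scalerAr.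
by rewrite scalerA /lambda natrM.
Qed.

(** The tensor product of the comodules of K, z and L. Its coefficients span at least K C L; [h1],
    [h2], [h3] show this one factor at a time. *)
Lemma sandwich_comatrix n (z : 'I_n -> 'I_n -> H) : comatrix z ->
  exists (I : finType) (y : I -> I -> H), [/\ comatrix y, ch y = T (ch z) &
    forall psi : 'Hom(H, k^o), (forall i j, psi (y i j) = 0) ->
      forall v, v \in (K * coef_space (ch z) * L)%VS -> psi v = 0].
Proof.
move=> cz; have [x [cx chx xK]] := hopf_comatrix SS chi_int hK intK epsK.
have [w [cw chw wL]] := hopf_comatrix SS chi_int hL intL epsL.
pose xz a b := x a.1 b.1 * z a.2 b.2.
have cxz : comatrix xz := comatrix_mul cx cz.
exists _, (fun a b => xz a.1 b.1 * w a.2 b.2); split.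
- exact: comatrix_mul.
- by rewrite ch_mul ch_mul chx chw sandwichE.
move=> psi psi0.
have lin_psi (F : H -> H) : lin F -> exists F' : 'Hom(H, k^o), F' =1 psi \o F.
  move=> lF; exists (linfun (fun v => psi (F v) : k^o)) => v.
  by rewrite lin_linfunE //; lin.
have h1 a b c c' : forall l, l \in L -> psi (x a b * z c c' * l) = 0.
  have [F FE] := lin_psi (fun l => x a b * z c c' * l) ltac:(lin).
  move=> l /(wL F); rewrite !FE; apply => i j.
  by rewrite FE; apply: (psi0 (a, c, i) (b, c', j)).
have h2 a b c l : c \in coef_space (ch z) -> l \in L -> psi (x a b * c * l) = 0.
  move=> + lL; have [F FE] := lin_psi (fun c => x a b * c * l) ltac:(lin).
  have -> : psi (x a b * c * l) = F c by rewrite FE.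
  move=> cC; apply/eqP; rewrite -memv_ker; move: c cC; apply/subvP.
  apply: (coef_space_sub cz) => i j; rewrite memv_ker FE /=; apply/eqP; exact: h1.
have h3 a c l : a \in K -> c \in coef_space (ch z) -> l \in L -> psi (a * c * l) = 0.
  move=> + cC lL; have [F FE] := lin_psi (fun a => a * c * l) ltac:(lin).
  move=> /(xK F); rewrite !FE; apply => i j.
  by rewrite FE /= h2.
move=> v vD.
apply/eqP; rewrite -memv_ker; move: v vD; apply/subvP/prodvP => v l vKC lL.
have [F FE] := lin_psi (fun v => v * l) ltac:(lin).
rewrite memv_ker -[psi _]/((psi \o (fun v => v * l)) v) -FE -memv_ker.
move: v vKC; apply/subvP/prodvP => a c aK cC.
by rewrite memv_ker FE /= h3.
Qed.

(* The matrix of T has nonnegative integer entries, since T maps characters to characters. *)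
Lemma sandwich_irr : exists m : 'I_N -> 'I_N -> nat,
  forall i, T (e i) = \sum_j (m i j)%:R *: e j.
Proof.
apply: (@fin_all_exists _ _ (fun i m => T (e i) = \sum_j (m j)%:R *: e j)) => i.
have [n [z [[cz _ _] ez]]] := irr_nth hirr i.
have [I [y [cy chy _]]] := sandwich_comatrix cz.
have [m em] := comatrix_decomp hirr (comatrix_enum cy).
by exists m; rewrite -em ch_enum chy -ez.
Qed.

Variable m : 'I_N -> 'I_N -> nat.
Hypothesis Tm : forall i, T (e i) = \sum_j (m i j)%:R *: e j.

Lemma mult_chi i j : chi (S (e j) * T (e i)) = (m i j)%:R * chi 1 :> k.
Proof. by rewrite Tm (irr_coef SS chi_int chiS hirr (fun j => (m i j)%:R)). Qed.

Lemma mult_sym i j : m i j = m j i.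
Proof.
have chi1 : chi 1 != 0 :> k by rewrite gt_eqF // reg_char1_gt0.
apply/eqP; rewrite -(eqr_nat k); apply/eqP/(mulIf chi1); rewrite -!mult_chi.
rewrite -chiS !sandwichE !antipodeM SS (antipode_integral SS hK intK epsK).
by rewrite (antipode_integral SS hL intL epsL) -!mulrA reg_charC -!mulrA.
Qed.

Lemma mult_counit i : \sum_j (m i j)%:R * d j = lambda * d i.
Proof.
have := congr1 eps (Tm i); rewrite sandwichE !counitM epsK epsL linear_sum /= => e1.
transitivity (\sum_j eps ((m i j)%:R *: e j) : k).
  by apply: eq_bigr => j _; rewrite linearZ.
by rewrite -e1 /lambda natrM mulrAC.
Qed.

Lemma mult_sqr i l : \sum_j (m i j)%:R * (m j l)%:R = lambda * (m i l)%:R.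
Proof.
have chi1 : chi 1 != 0 :> k by rewrite gt_eqF // reg_char1_gt0.
apply: (mulIf chi1); rewrite -mulrA -mult_chi.
transitivity (chi (S (e l) * T (T (e i)))).
  rewrite Tm linear_sum mulr_sumr linear_sum /= mulr_suml; apply: eq_bigr => j _.
  by rewrite linearZ -scalerAr linearZ /= mult_chi /GRing.scale /= mulrA.
by rewrite sandwich_idem -scalerAr linearZ.
Qed.

Lemma irr_relP i j :
  irr_rel K L irr i j <-> (coef_space (e i) <= K * coef_space (e j) * L)%VS.
Proof.
split=> [/asboolP[Cc [Cd [/subcoalg_of_coef -> /subcoalg_of_coef ->]]]|sub] //.
apply/asboolP; exists (coef_space (e i)), (coef_space (e j)).
by split=> //; exact: irr_subcoalg.
Qed.

(* If C_i is contained in K C_j L, which is spanned by the coefficients w' of the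
   representation with character T e_j, then averaging gives a nonzero intertwiner
   from e_i to w', that is e_i occurs in T e_j. *)
Lemma irr_rel_mult i j : irr_rel K L irr i j = (m j i != 0)%N.
Proof.
have [n [z [zirr ez]]] := irr_nth hirr i; have [cz n0 _] := zirr.
have [q [y [[cy _ _] ey]]] := irr_nth hirr j.
apply/idP/idP => [/irr_relP sub|mji].
  have [I [w [cw chw spanw]]] := sandwich_comatrix cy.
  pose w' (a b : 'I_#|I|) := w (enum_val a) (enum_val b).
  have cw' : comatrix w' := comatrix_enum cw.
  have [[a [b [c [l nz]]]]|vanish] := EM (exists a b c l, chi (S (z a b) * w' c l) != 0 :> k).
    pose F := \matrix_(s, t) (chi (S (z s b) * w' c t) : k).
    have F0 : F != 0.
      by apply: contraNneq nz => /matrixP/(_ a l); rewrite !mxE => ->.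
    have zF f : evm z f *m F = F *m evm w' f := intertwiner chi_int b c f cz cw'.
    have fF := schur_free zirr zF F0.
    have [p [x [_ cx chx]]] := comatrix_quot cw' cz fF zF.
    have [m' em'] := comatrix_decomp hirr cx.
    have eT : T (e j) = \sum_l ((l == i) + m' l)%:R *: e l.
      rewrite /e ey -chw -ch_enum -/w' chx em' -ez.
      rewrite (bigD1 i) //= [RHS](bigD1 i) //= eqxx natrD scalerDl scale1r addrA.
      by congr (_ + _); apply: eq_bigr => t /negPf ->.
    have chi1 : chi 1 != 0 :> k by rewrite gt_eqF // reg_char1_gt0.
    have := mult_chi j i; rewrite eT.
    rewrite (irr_coef SS chi_int chiS hirr (fun l => ((l == i) + m' l)%:R)).
    by move=> /(mulIf chi1)/eqP; rewrite eqr_nat eqxx => /eqP <-.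
  (* If all these averages vanish, chi(S(z_oo) _) kills K C_j L, which contains z_oo, against
     orthonormality. *)
  pose o := Ordinal n0.
  pose psi : 'Hom(H, k^o) := linfun (fun x => chi (S (z o o) * x)).
  have psiE x : psi x = chi (S (z o o) * x) by rewrite lin_linfunE //; lin.
  have psi0 : psi (z o o) = 0.
    apply: spanw => [a b|].
      rewrite psiE; apply/eqP; apply: contrapT => /negP nz; apply: vanish.
      by exists o, o, (enum_rank a), (enum_rank b); rewrite /w' !enum_rankK.
    rewrite -ey; apply: (subvP sub).
    apply: (coef_in_subcoalg SS chi_int chiS hirr _ _ _ zirr ez (c := fun l => (l == i)%:R)).
    - exact: left_coideal_coef.
    - rewrite (bigD1 i) //= eqxx scale1r big1 ?addr0 ?mem_coef_space // => l /negPf ->.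
      by rewrite scale0r.
    by rewrite eqxx oner_eq0.
  move/eqP: psi0; rewrite psiE (coef_orthonormal SS chi_int chiS) // eqxx mul1r.
  by rewrite !mulf_eq0 invr_eq0 pnatr_eq0 -[n == 0%N]leqn0 leqNgt n0 gt_eqF ?reg_char1_gt0.
(* Conversely, the left coideal K C_j L contains T e_j, hence the coefficients of every irreducible
   character occurring there. *)
apply/irr_relP; rewrite [e i]ez; apply: (coef_space_sub cz).
apply: (coef_in_subcoalg SS chi_int chiS hirr _ _ _ zirr ez (c := fun l => (m j l)%:R)).
- by apply/left_coidealM/left_coideal_hopf/hL/left_coidealM/left_coideal_coef/left_coideal_hopf.
- rewrite -Tm sandwichE memv_mul ?intL.1 // memv_mul ?intK.1 //.
  exact: mem_coef_space.
by rewrite pnatr_eq0.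
Qed.

(** Symmetry is that of the multiplicities; reflexivity uses 1 in K and L, transitivity K K = K and
    L L = L. *)
Lemma irr_rel_equiv : equivalence_rel (irr_rel K L irr).
Proof.
have rel_sym i j : irr_rel K L irr i j = irr_rel K L irr j i.
  by rewrite !irr_rel_mult mult_sym.
have [K1 _ _] := hK; have [L1 _ _] := hL.
have rel_trans i j l : irr_rel K L irr i j -> irr_rel K L irr j l -> irr_rel K L irr i l.
  move=> /irr_relP ij /irr_relP jl; apply/irr_relP; apply: (subv_trans ij).
  apply: (subv_trans (prodvS (prodvS (subvv K) jl) (subvv L))).
  by rewrite !prodvA prodv_id -!prodvA prodv_id.
move=> i j l; split.
  apply/irr_relP; apply/subvP => v vC; rewrite -[v]mul1r -[1 * v]mulr1.
  by rewrite !memv_mul.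
by move=> ij; apply/idP/idP; apply: rel_trans; rewrite // rel_sym.
Qed.

Lemma op_mx_sandwich : op_mx irr T = \matrix_(i, j) (m i j)%:R.
Proof.
apply/matrixP => i j; rewrite !mxE -/(e i) Tm coord_sum_free //.
exact: (irr_free SS chi_int chiS hirr).
Qed.

Lemma sandwich_principal : principal_eigenvalue (op_mx irr T) lambda.
Proof.
rewrite op_mx_sandwich; set M := \matrix_(i, j) _.
split; last 2 first.
- exact: ltW lambda_gt0.
- move=> b /eigenvalueP[v vM v0].
  (* This leaves only 0 and lambda as possible eigenvalues. *)
  have MM : M *m M = lambda *: M.
    apply/matrixP => i l; rewrite !mxE -mult_sqr.
    by apply: eq_bigr => j _; rewrite !mxE.
  have e2 : b *: (b *: v) = lambda *: (b *: v).
    transitivity (v *m M *m M); first by rewrite vM -scalemxAl vM.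
    by rewrite -mulmxA MM -scalemxAr vM.
  have : (b * (b - lambda)) *: v = 0.
    by rewrite mulrBr scalerBl -scalerA e2 scalerA mulrC subrr.
  move/eqP; rewrite scaler_eq0 (negPf v0) orbF mulf_eq0 subr_eq0.
  have l0 := ltW lambda_gt0.
  by case/orP => /eqP ->; rewrite ?normr0 // ger0_norm.
apply/eigenvalueP; exists (\row_j d j).
  apply/rowP => j; rewrite !mxE -mult_counit; apply: eq_bigr => i _.
  by rewrite !mxE mulrC mult_sym.
(* The trivial character 1 belongs to [irr], so the vector of degrees is not empty. *)
have /hirr.2 irr1 := grouplike_irr (grouplike1 H).
have N0 : (0 < N)%N by rewrite -(size_tuple irr) -has_predT; apply/hasP; exists 1.
apply: contraTneq (counit_irr_gt0 (Ordinal N0)) => /rowP/(_ (Ordinal N0)).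
by rewrite !mxE => ->; rewrite ltxx.
Qed.

Lemma sandwich_char_ring : (T @: char_ring H <= char_ring H)%VS.
Proof.
have bC := irr_basis SS chi_int chiS hirr.
rewrite -(span_basis bC) limg_span; apply/span_subvP => _ /mapP[x xirr ->].
have iN : (index x irr < N)%N by rewrite -[X in (_ < X)%N](size_tuple irr) index_mem.
have -> : x = e (Ordinal iN) by rewrite /e nth_index.
rewrite Tm; apply: memv_suml => j _; rewrite memvZ // memv_span //.
by rewrite mem_nth ?size_tuple.
Qed.

Lemma irr_classesP B i j : B \in irr_classes K L irr -> i \in B ->
  (j \in B) = irr_rel K L irr i j.
Proof.
move=> /imsetP[l _ ->].
have inB x : (x \in [set y in [set: 'I_N] | irr_rel K L irr l y]) = irr_rel K L irr l x.
  by rewrite finset.in_set finset.in_setT.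
rewrite !inB => li.
by have [_ lE] := irr_rel_equiv l i j; apply: lE li.
Qed.

(** The multiplicities vanish between different classes, so the eigenvector equation of the degrees
    can be restricted to [B]. *)
Lemma class_sum_eigen B : B \in irr_classes K L irr ->
  T (class_sum irr B) = lambda *: class_sum irr B.
Proof.
move=> PB; rewrite /class_sum linear_sum scaler_sumr /=.
transitivity (\sum_(i in B) \sum_(j in B) (d i * (m i j)%:R) *: e j).
  apply: eq_bigr => i iB; rewrite linearZ /= -/(e i) -/(d i) Tm scaler_sumr.
  rewrite [RHS]big_mkcond; apply: eq_bigr => j _; rewrite scalerA.
  rewrite (irr_classesP _ PB iB) irr_rel_mult mult_sym.
  by case: eqVneq => // ->; rewrite mulr0 scale0r.
rewrite exchange_big; apply: eq_bigr => j jB; rewrite -scaler_suml scalerA.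
congr (_ *: _); rewrite -/(e j) -/(d j) -mult_counit [LHS]big_mkcond.
apply: eq_bigr => i _; rewrite (irr_classesP _ PB jB) irr_rel_mult mulrC mult_sym.
by rewrite mult_sym; case: eqVneq => // ->; rewrite mul0r.
Qed.

Lemma class_sum_basis :
  basis_of (char_ring H :&: passmx.leigenspace T lambda)%VS
    [seq class_sum irr B | B <- enum (irr_classes K L irr)].
Proof.
have chi1 : chi 1 != 0 :> k by rewrite gt_eqF // reg_char1_gt0.
have bC := irr_basis SS chi_int chiS hirr.
have partP : partition (irr_classes K L irr) [set: 'I_N].
  by apply: equivalence_partitionP => i j l _ _ _; apply: irr_rel_equiv.
have [/eqP covP trivP PN0] := and3P partP.
have class_coef (i : 'I_N) B : chi (S (e i) * class_sum irr B) = (i \in B)%:R * d i * chi 1 :> k.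
  have -> : class_sum irr B = \sum_j ((j \in B)%:R * d j) *: irr`_j.
    rewrite /class_sum big_mkcond; apply: eq_bigr => j _.
    by case: (j \in B); rewrite ?mul1r // mul0r scale0r.
  exact: (irr_coef SS chi_int chiS hirr (fun j => (j \in B)%:R * d j)).
(* Up to chi(1), the coefficient of x at a chosen member of [B]; classes are nonempty, so the
   default 0 never occurs for them. *)
pose phi (B : {set 'I_N}) (x : H) : k^o :=
  if [pick i in B] is Some i then chi (S (e i) * x) else 0.
have nonempty B : B \in irr_classes K L irr -> exists i, i \in B.
  move=> PB; apply/set0Pn; apply: contraNneq PN0 => <-; exact: PB.
apply/andP; split; last first.
  apply: (@free_dual _ _ _ _ _ phi).
  - exact: enum_uniq.
  - move=> B; rewrite /phi; case: pickP => [i _|_]; first by lin.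
    by move=> a u v; rewrite scaler0 addr0.
  - move=> B; rewrite mem_enum => PB; rewrite /phi; case: pickP => [i iB|nB].
      by rewrite class_coef iB mul1r mulf_neq0 // gt_eqF // counit_irr_gt0.
    by have [i iB] := nonempty _ PB; have := nB i; rewrite /= iB.
  move=> B B'; rewrite !mem_enum => PB PB' BB'; rewrite /phi; case: pickP => // i iB.
  rewrite class_coef (_ : i \in B' = false) ?mul0r //; apply/negbTE.
  apply: contraNN BB' => iB'.
  by rewrite -(def_pblock trivP PB iB) (def_pblock trivP PB' iB').
rewrite eqEsubv; apply/andP; split.
  apply/span_subvP => x /mapP[B]; rewrite mem_enum => PB ->.
  rewrite memv_cap; apply/andP; split.
    rewrite /class_sum; apply: memv_suml => i _; rewrite memvZ //.
    by apply: (basis_mem bC); rewrite mem_nth ?size_tuple.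
  rewrite memv_ker add_lfunE opp_lfunE scale_lfunE id_lfunE subr_eq0; apply/eqP.
  exact: class_sum_eigen.
apply/subvP => x; rewrite memv_cap memv_ker => /andP[xC].
rewrite add_lfunE opp_lfunE scale_lfunE id_lfunE subr_eq0 => /eqP Tx.
pose v i := coord irr i x.
have ex : x = \sum_i v i *: e i := coord_basis bC xC.
(* By symmetry of [m] the coefficients of an eigenvector satisfy the equation of the degrees, so
   [perron_const] makes v / d constant on each class. *)
have mv i : \sum_j (m i j)%:R * v j = lambda * v i.
  apply: (mulIf chi1); rewrite -mulrA -(irr_coef SS chi_int chiS hirr v) -ex.
  transitivity (chi (S (e i) * T x)); last by rewrite Tx -scalerAr linearZ.
  rewrite {1}ex linear_sum mulr_sumr linear_sum mulr_suml; apply: eq_bigr => j _.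
  by rewrite linearZ /= -scalerAr linearZ /= mult_chi mult_sym /GRing.scale /= mulrA [_ * v j]mulrC.
have vd i j : irr_rel K L irr i j -> v i = v j / d j * d i.
  rewrite irr_rel_mult => mji.
  rewrite -(perron_const (m := fun i j => (m i j)%:R) _ _ counit_irr_gt0 mult_counit mv (i := i)).
  - by rewrite divfK // gt_eqF // counit_irr_gt0.
  - by move=> a b; rewrite ler0n.
  - by move=> a b; rewrite mult_sym.
  by rewrite pnatr_eq0 mult_sym.
rewrite ex (eq_bigl (mem [set: 'I_N])) => [|i]; last by rewrite !inE.
rewrite -covP big_trivIset //=; apply: memv_suml => B PB.
have [j jB] := nonempty _ PB.
have -> : \sum_(i in B) v i *: e i = (v j / d j) *: class_sum irr B.
  rewrite /class_sum scaler_sumr; apply: eq_bigr => i iB.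
  by rewrite scalerA -vd // -(irr_classesP _ PB iB).
by rewrite memvZ // memv_span //; apply/mapP; exists B; rewrite ?mem_enum.
Qed.

End Main.

Theorem theorem2p5 (R : realType) (H : hopfType R[i]) (ssH : semisimple H)
    (K L : {aspace H}) (hK : hopf_subalgebra K) (hL : hopf_subalgebra L)
    (LambdaK LambdaL : H)
    (intK : hopf_integral K LambdaK) (epsK : counit LambdaK = (\dim K)%:R :> R[i])
    (intL : hopf_integral L LambdaL) (epsL : counit LambdaL = (\dim L)%:R :> R[i])
    (n : nat) (irr : n.-tuple H) (hirr : irr_enum irr) :
  let CH := char_ring H in
  let T := sandwich LambdaK LambdaL in
  let lambda : R[i] := (\dim K * \dim L)%:R in
  (* the operator, its matrix and the equivalence classes are well defined; then (1) and (2) *)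
  [/\ (T @: CH <= CH)%VS, basis_of CH irr & equivalence_rel (irr_rel K L irr)]
  /\ principal_eigenvalue (op_mx irr T) lambda
  /\ basis_of (CH :&: passmx.leigenspace T lambda)%VS
       [seq class_sum irr B | B <- enum (irr_classes K L irr)].
Proof.
have gl (g : H) : grouplike g -> g \in irr by move=> /grouplike_irr /hirr.2.
have [SS chi_int chiS] := larson_radford ssH gl.
have [m Tm] := sandwich_irr hirr SS chi_int hK hL intK epsK intL epsL.
move=> CH T lambda; split.
  split.
  - exact: (sandwich_char_ring hirr SS chi_int chiS Tm).
  - exact: (irr_basis SS chi_int chiS hirr).
  - exact: (irr_rel_equiv hirr SS chi_int chiS hK hL intK epsK intL epsL Tm).
split.
  exact: (sandwich_principal hirr SS chi_int chiS hK hL intK epsK intL epsL Tm).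
exact: (class_sum_basis hirr SS chi_int chiS hK hL intK epsK intL epsL Tm).
Qed.
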